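(* Let $\mathbf U=\mathbf H(z,\mathbf U)$ be an irreducible system of dimension $m$, let $\mathbf U(z)$ be its generating function solution and $\rho$ its radius of convergence. Let $u$ be a coordinate of $\mathbf U$ such that $u(\rho)>1$. Then there exists $\boldsymbol\zeta=(t,\mathbf B)\in(0,\rho)\times\mathbb R_{\ge0}^m$ with $u(t)=1$ and $\mathbf B=\mathbf U(t)$, and a neighborhood of $\boldsymbol\zeta$ such that Newton's iteration for the system $\{\mathbf U=\mathbf H(z,\mathbf U),\ u=1\}$ (in the unknowns $z,\mathbf U$) converges quadratically to $\boldsymbol\zeta$ when started in this neighborhood.
   Context: Let $\mathbf H=(H_1,\dots,H_m)$, written $\mathbf H(z,\mathbf U)$, be analytic near $\mathbf 0\in\mathbb C^{m+1}$; its domain of convergence is that of its Taylor series at $\mathbf 0$. The system is well founded when (i) each $H_i$ has nonnegative real Taylor coefficients at $\mathbf 0$; (ii) with $\mathbf V^{[0]}=\mathbf 0$, for $k=0,\dots,m$, $(0,\mathbf V^{[k]})$ lies in the domain of convergence, so that $\mathbf V^{[k+1]}=\mathbf H(0,\mathbf V^{[k]})$ is defined; (iii) $\partial\mathbf H/\partial\mathbf U$ at $(0,\mathbf V^{[m]})$ is nilpotent. The generating function solution is the unique solution analytic near $0$ with value $\mathbf V^{[m]}$ at $0$; $u(\rho)$ means its limit as $z\to\rho^-$ (possibly $+\infty$). The system is irreducible if it is well founded, zero-free (no coordinate of the solution identically zero), recursive ($\partial\mathbf H/\partial\mathbf U$ not nilpotent) and its dependency graph (edge $i\to j$ when $H_i$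 depends on $U_j$) is strongly connected.
   Formalization: The hypothesis u(0)<1 is added; without it the claim fails, e.g. for U=2+zU with solution 2/(1−z), where u(ρ)=+∞>1 but u≥2 on [0,1), so no t in (0,ρ) has u(t)=1. *)

(* Defs.v *)
From HB Require Import structures.
From mathcomp Require Import all_boot all_order all_algebra.
From mathcomp Require Import complex.
From mathcomp Require Import all_classical all_reals all_analysis.
Set Implicit Arguments.
Unset Strict Implicit.
Unset Printing Implicit Defensive.
Import Order.TTheory GRing.Theory Num.Theory.
Import numFieldNormedType.Exports.
Local Open Scope classical_set_scope.
Local Open Scope ring_scope.
Local Open Scope complex_scope.

(* R[i] viewed as a numFieldType, so that it and the matrices over it receive
   the topology and the norm of numFieldNormedType.  The order is the partial
   order of R[i]: 0 <= c means that c is a nonnegative real number. *)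
Definition Cplx (R : realType) : numFieldType := R[i].

Definition toC (R : realType) (x : R) : Cplx R := x%:C.
Definition reC (R : realType) (z : Cplx R) : R := complex.Re z.

Section MultivariateSeries.
Variable R : realType.
Local Notation C := (Cplx R).

Definition mcoefs (n : nat) := {ffun 'I_n -> nat} -> C.

(* Partial sums of sum_k a_k x^k over the boxes {k | k_i < N for all i}; for an
   absolutely convergent series every exhaustion of the multi-indices gives the
   same sum. *)
Definition mseries n (a : mcoefs n) (x : 'rV[C]_n) (N : nat) : C :=
  \sum_(k : {ffun 'I_n -> 'I_N})
    a [ffun i => val (k i)] * \prod_(i < n) x 0 i ^+ val (k i).

Definition abs_cvg n (a : mcoefs n) : set 'rV[C]_n :=
  [set x | cvgn (mseries (fun k => `|a k|) (map_mx Num.norm x))].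

Definition msum n (a : mcoefs n) (x : 'rV[C]_n) : C := limn (mseries a x).

End MultivariateSeries.

Section Systems.
Variables (R : realType) (m : nat).
Local Notation C := (Cplx R).

(* A germ of analytic map at 0 in C^(m+1) is given by its Taylor coefficients;
   variable 0 is z and variable j.+1 is U_j. *)
Definition system := 'I_m -> mcoefs R (1 + m).
Implicit Type h : system.

Definition conv_dom h : set 'rV[C]_(1 + m) :=
  interior [set x | forall i, abs_cvg (h i) x].

Definition sys_map h (x : 'rV[C]_(1 + m)) : 'rV[C]_m := \row_i msum (h i) x.

Definition zU_point (z : C) (v : 'rV[C]_m) : 'rV[C]_(1 + m) :=
  row_mx (z%:M : 'M[C]_1) v.

(* The library Jacobian acts on row vectors: 'J f x j i is the derivative of the
   i-th component with respect to the j-th variable. *)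
Definition dHdU h (x : 'rV[C]_(1 + m)) : 'M[C]_m :=
  (dsubmx ('J (sys_map h) x))^T.

Definition wf_iter h (k : nat) : 'rV[C]_m :=
  iter k (fun v => sys_map h (zU_point 0 v)) 0.

Definition well_founded_system h : Prop :=
  [/\ conv_dom h 0,
      forall i k, 0 <= h i k,
      forall k, (k <= m)%N -> conv_dom h (zU_point 0 (wf_iter h k)) &
      exists p : nat, dHdU h (zU_point 0 (wf_iter h m)) ^+ p = 0].

(* m univariate power series, the i-th one having coefficients u i. *)
Definition gf := 'I_m -> nat -> C.
Implicit Type u : gf.

Definition gf_cvg u : set C :=
  [set z | forall i, cvgn (series (fun n => u i n * z ^+ n))].

Definition gf_val u (z : C) : 'rV[C]_m :=
  \row_i limn (series (fun n => u i n * z ^+ n)).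

Definition gf_solution h u : Prop :=
  [/\ \forall z \near (0 : C), gf_cvg u z,
      \forall z \near (0 : C), conv_dom h (zU_point z (gf_val u z)) /\
        gf_val u z = sys_map h (zU_point z (gf_val u z)) &
      gf_val u 0 = wf_iter h m].

Definition conv_radius u : \bar R :=
  ereal_sup [set (reC `|z|)%:E | z in gf_cvg u].

(* The limit is taken in \bar R along x < conv_radius u, which also covers an
   infinite radius of convergence. *)
Definition value_at_radius u (i : 'I_m) : \bar R :=
  lim ((reC (gf_val u (toC (fine x)) 0 i))%:E
       @[x --> within (fun y : \bar R => (y < conv_radius u)%E) (nbhs (conv_radius u))]).

Definition zero_free h : Prop :=
  forall u, gf_solution h u ->
  forall i, ~ \forall z \near (0 : C), gf_val u z 0 i = 0.

(* dH/dU is not nilpotent as a matrix of analytic functions. *)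
Definition recursive h : Prop :=
  ~ exists p : nat, forall x, conv_dom h x -> dHdU h x ^+ p = 0.

Definition depends_on h (i j : 'I_m) : Prop :=
  exists k : {ffun 'I_(1 + m) -> nat}, (0 < k (rshift 1 j))%N /\ h i k != 0.

Definition dependency_graph h : rel 'I_m := fun i j => `[< depends_on h i j >].

Definition irreducible_system h : Prop :=
  [/\ well_founded_system h, zero_free h, recursive h &
      forall i j, connect (dependency_graph h) i j].

(* The m + 1 equations U_i = 1 and U = H(z, U), in the form F = 0. *)
Definition augmented_map h (i : 'I_m) (x : 'rV[C]_(1 + m)) : 'rV[C]_(1 + m) :=
  zU_point (rsubmx x 0 i - 1) (rsubmx x - sys_map h x).

End Systems.

Section Newton.
Variables (R : realType) (n : nat).
Local Notation C := (Cplx R).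
Implicit Types (F : 'rV[C]_n -> 'rV[C]_n) (D : set 'rV[C]_n).

Definition newton_step F (x : 'rV[C]_n) : 'rV[C]_n :=
  x - F x *m invmx ('J F x).

(* The iteration is well defined along x0 when every iterate lies in the domain
   D of F and the Jacobian is invertible there. *)
Definition newton_cvg_quadratically_near F D (zeta : 'rV[C]_n) : Prop :=
  exists2 W : set 'rV[C]_n, nbhs zeta W &
  exists K : R, forall x0, W x0 ->
    let x k := iter k (newton_step F) x0 in
    [/\ forall k, D (x k) /\ 'J F (x k) \in unitmx,
        x k @[k --> \oo] --> zeta &
        forall k, `|x k.+1 - zeta| <= toC K * `|x k - zeta| ^+ 2].

End Newton.

(* Main.v *)
(* Let U = sum_n U_n z^n be the solution.  Near 0 the coefficient of z^n in
   U = H(z, U) can be computed termwise; for n > 0 this gives U_n = g_n + D U_n,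
   where D = dH/dU at the initial value is nilpotent and g_n is a combination
   with nonnegative weights of products of U_0, ..., U_(n-1).  Hence U_n >= 0 by
   induction, and exchanging the sums, now of nonnegative terms, extends the
   equation, with absolute convergence, to the whole of (0, rho).  For
   0 < t < rho, strict monotonicity of U then places (t, U(t)) in the interior
   of the domain of convergence, and the intermediate value theorem provides t
   with u(t) = 1.

   Let M = dH/dU and b = dH/dz at (t, U(t)).  By convexity of H, any y in
   (t, rho) yields w = U(y) - U(t) > 0 with (y - t) b + M w <= w, where b is not
   zero.  As M is irreducible, every v with M v <= v then vanishes or is
   positive.  A kernel vector (a, v) of the Jacobian of the augmented system has
   v_i = 0 and v = a b + M v, hence is zero: the Jacobian is invertible, and the
   quadratic convergence of Newton's iteration follows from an expansion of H to
   second order whose remainder is uniform near (t, U(t)). *)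

From HB Require Import structures.
From mathcomp Require Import all_boot all_order all_algebra.
From mathcomp Require Import complex.
From mathcomp Require Import ring lra.
From mathcomp Require Import all_classical all_reals all_analysis.
Require Import Defs.
Set Implicit Arguments.
Unset Strict Implicit.
Unset Printing Implicit Defensive.
Import Order.TTheory GRing.Theory Num.Theory.
Import numFieldNormedType.Exports.
Local Open Scope classical_set_scope.
Local Open Scope ring_scope.

(** * Second-order approximation *)

Section MatrixNorm.
Variable K : numFieldType.

Lemma ler_mx_norm m n (A : 'M[K]_(m, n)) e :
  0 <= e -> (forall i j, `|A i j| <= e) -> `|A| <= e.
Proof.
move=> /nonnegP[{}e] Ae; rewrite /Num.norm/= mx_normE num_le.
apply/bigmax_leP => /=; split; last by case=> i j _; exact: Ae.
by rewrite -num_le /=.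
Qed.

Lemma ler_norm_entry m n (A : 'M[K]_(m, n)) i j : `|A i j| <= `|A|.
Proof.
rewrite [leRHS]/Num.norm/= mx_normE.
have -> : `|A i j| = `|A (i, j).1 (i, j).2|%:nng%:num by [].
by rewrite num_le; exact: (le_bigmax _ (fun ij => `|A ij.1 ij.2|%:nng)).
Qed.

Lemma ler_norm_mulmx m n (x : 'rV[K]_m) (A : 'M[K]_(m, n)) :
  `|x *m A| <= (m%:R * `|A|) * `|x|.
Proof.
apply: ler_mx_norm => [|i j]; first by rewrite !mulr_ge0.
rewrite mxE; apply: le_trans (ler_norm_sum _ _ _) _.
have -> : m%:R * `|A| * `|x| = \sum_(k < m) `|x| * `|A|.
  by rewrite sumr_const card_ord -[RHS]mulr_natl mulrAC mulrA.
by apply: ler_sum => k _; rewrite normrM ler_pM ?ler_norm_entry.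
Qed.

Lemma mulmxr_continuous m n (A : 'M[K]_(m, n)) :
  continuous (mulmxr A : 'rV[K]_m -> 'rV[K]_n).
Proof.
move=> x; apply/(@cvgrPdist_lt _ _ _ (nbhs (x : 'rV[K]_m)) _) => e e0.
near=> y; rewrite /= -mulmxBl; apply: le_lt_trans (ler_norm_mulmx _ _) _.
apply: le_lt_trans (_ : _ <= (m%:R * `|A| + 1) * `|x - y|) _.
  by rewrite ler_wpM2r// lerDl.
rewrite mulrC -ltr_pdivlMr//; near: y.
by apply: cvgr_dist_lt => //; rewrite divr_gt0.
Unshelve. all: by end_near. Qed.

Lemma unitmx_of_injective (F : fieldType) n (A : 'M[F]_n) :
  (forall v : 'rV[F]_n, v *m A = 0 -> v = 0) -> A \in unitmx.
Proof.
move=> injA; rewrite -row_free_unit -kermx_eq0; apply/rowV0P => v.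
by move=> /sub_kermxP/injA.
Qed.

End MatrixNorm.

Section QuadraticApproximation.
Variables (K : numFieldType) (n p : nat).

Definition quad_approx (F : 'rV[K]_n -> 'rV[K]_p) (L : 'rV[K]_n -> 'M[K]_(n, p))
    (x0 : 'rV[K]_n) (d B : K) : Prop :=
  forall x y, `|x - x0| < d -> `|y - x0| < d ->
    `|F y - F x - (y - x) *m L x| <= B * `|y - x| ^+ 2.

Variables (F : 'rV[K]_n -> 'rV[K]_p) (L : 'rV[K]_n -> 'M[K]_(n, p)).
Variables (x0 : 'rV[K]_n) (d B : K).
Hypotheses (B_ge0 : 0 <= B) (F_approx : quad_approx F L x0 d B).

Lemma quad_approx_jacobian (x : 'rV[K]_n) : `|x - x0| < d -> 'J F x = L x.
Proof.
move=> xd; suff dF : 'd F x = mulmxr (L x) :> (_ -> _).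
  apply/matrixP => i j; rewrite /jacobian.
  have := mul_rV_lin1 ('d F x) (delta_mx 0 i).
  by rewrite dF/= -!rowE => /rowP/(_ j); rewrite !mxE.
apply: diff_unique; first exact: mulmxr_continuous.
apply/eqaddoP => e e0.
have small r : 0 < r -> \forall y \near nbhs (0 : 'rV[K]_n), `|y| < r.
  move=> r0; apply/nbhs_ballP; exists r => //= y.
  by rewrite -ball_normE/= sub0r normrN.
near=> y.
rewrite opprD addrA.
rewrite [X in `|X|](_ : _ = F (y + x) - F x - y *m L x); last by [].
have := F_approx xd (y := y + x); rewrite addrK => Fy.
apply: le_trans (Fy _) _.
  have -> : y + x - x0 = (x - x0) + y by rewrite -addrA addrC.
  apply: le_lt_trans (ler_normD _ _) _; rewrite addrC -ltrBrDr.
  by near: y; apply: small; rewrite subr_gt0.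
rewrite expr2 mulrA ler_wpM2r//.
apply: le_trans (_ : _ <= (B + 1) * `|y|) _; first by rewrite ler_wpM2r// lerDl.
rewrite mulrC -ler_pdivlMr ?ltr_wpDl//.
by apply: ltW; near: y; apply: small; rewrite divr_gt0 ?ltr_wpDl.
Unshelve. all: by end_near. Qed.

(* Compare the expansions at [x0] and at [x] along the triangle [x0], [x],
   [x + f]. *)
Lemma quad_approx_gradientB (x f : 'rV[K]_n) :
  `|x - x0| < d -> `|x - x0 + f| < d ->
  `|f *m (L x - L x0)| <= B * (`|f| ^+ 2 + `|x - x0 + f| ^+ 2 + `|x - x0| ^+ 2).
Proof.
move=> xd xfd.
have x0d : `|x0 - x0| < d by rewrite subrr normr0 (le_lt_trans _ xd).
have xfE : x + f - x0 = x - x0 + f by rewrite addrAC.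
have xfx : x + f - x = f by rewrite addrC addKr.
rewrite -xfE in xfd *.
have -> : f *m (L x - L x0) =
    (F (x + f) - F x0 - (x + f - x0) *m L x0)
    - (F (x + f) - F x - (x + f - x) *m L x)
    - (F x - F x0 - (x - x0) *m L x0).
  rewrite xfx xfE mulmxDl mulmxBr.
  move: (F (x + f)) (F x) (F x0) (f *m L x) (f *m L x0) ((x - x0) *m L x0).
  by move=> Fxf Fx Fx0 fL fL0 xL0; apply/matrixP => i j; rewrite !mxE; ring.
have -> : B * (`|f| ^+ 2 + `|x + f - x0| ^+ 2 + `|x - x0| ^+ 2) =
    B * `|x + f - x0| ^+ 2 + B * `|x + f - x| ^+ 2 + B * `|x - x0| ^+ 2.
  by rewrite xfx; ring.
apply: le_trans (ler_normB _ _) (lerD _ (F_approx x0d xd)).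
exact: le_trans (ler_normB _ _) (lerD (F_approx x0d xfd) (F_approx xd xfd)).
Qed.

Lemma quad_approx_lipschitz (x e : 'rV[K]_n) : `|x - x0| + `|x - x0| < d ->
  `|e *m (L x - L x0)| <= 6%:R * B * `|x - x0| * `|e|.
Proof.
move=> xd; set r := `|x - x0|; have r_ge0 : 0 <= r by exact: normr_ge0.
have [/eqP|rN0] := eqVneq r 0.
  rewrite normr_eq0 subr_eq0 => /eqP ->.
  by rewrite subrr mulmx0 normr0 !mulr_ge0.
have [->|eN0] := eqVneq e 0; first by rewrite mul0mx !normr0 mulr0.
have r_gt0 : 0 < r by rewrite lt_def rN0.
have e_gt0 : 0 < `|e| by rewrite normr_gt0.
pose f := (r / `|e|) *: e.
have fr : `|f| = r by rewrite normrZ normrM normfV !normr_id divfK ?gt_eqF.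
have xf2r : `|x - x0 + f| <= r + r by rewrite -{2}fr ler_normD.
have xd' : `|x - x0| < d by apply: le_lt_trans xd; rewrite lerDl.
have : `|f *m (L x - L x0)| <= 6%:R * B * r * r.
  apply: le_trans (quad_approx_gradientB xd' (le_lt_trans xf2r xd)) _.
  rewrite fr -/r.
  have -> : 6%:R * B * r * r = B * (r ^+ 2 + (r + r) ^+ 2 + r ^+ 2) by ring.
  rewrite ler_wpM2l// lerD2r lerD2l lerXn2r ?nnegrE//.
  exact: addr_ge0.
rewrite -scalemxAl normrZ normrM normfV !normr_id -/r.
by rewrite (mulrC (r / _)) mulrA (mulrAC _ r) ler_pM2r// ler_pdivrMr.
Qed.

End QuadraticApproximation.

(** * Limits of complex sequences *)

Section ComplexLimits.
Variable R : realType.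
Local Notation C := (Cplx R).
Implicit Types (s t g : nat -> C) (a b : C).

Definition imC (z : C) : R := complex.Im z.

HB.instance Definition _ := GRing.RMorphism.copy (@toC R) (real_complex R).

Lemma reC_is_zmod_morphism : zmod_morphism (@reC R).
Proof. by case=> a b [c d]. Qed.
HB.instance Definition _ :=
  GRing.isZmodMorphism.Build (Cplx R) R (@reC R) reC_is_zmod_morphism.

Lemma imC_is_zmod_morphism : zmod_morphism imC.
Proof. by case=> a b [c d]. Qed.
HB.instance Definition _ :=
  GRing.isZmodMorphism.Build (Cplx R) R imC imC_is_zmod_morphism.

Lemma reC_toCM (x : R) (z : C) : reC (toC x * z) = x * reC z.
Proof. by case: z => a b; rewrite /reC/= mul0r subr0. Qed.

Lemma imC_toCM (x : R) (z : C) : imC (toC x * z) = x * imC z.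
Proof. by case: z => a b; rewrite /imC/= mul0r addr0. Qed.

Lemma ge0_reCK (z : C) : 0 <= z -> toC (reC z) = z.
Proof. by case: z => a b; rewrite lecE => /andP[/eqP/= -> _]. Qed.

Lemma reC_mul_ge0 (a b : C) : 0 <= a -> reC (a * b) = reC a * reC b.
Proof. by move=> /ge0_reCK <-; rewrite reC_toCM. Qed.

Lemma imC_mul_ge0 (a b : C) : 0 <= a -> imC (a * b) = reC a * imC b.
Proof. by move=> /ge0_reCK <-; rewrite imC_toCM. Qed.

Lemma eq_reC_imC (z w : C) : reC z = reC w -> imC z = imC w -> z = w.
Proof. by case: z w => [a b] [c d]; rewrite /reC /imC/= => -> ->. Qed.

Lemma le_toC (x y : R) : (toC x <= toC y) = (x <= y).
Proof. exact: lecR. Qed.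

Lemma lt_toC (x y : R) : (toC x < toC y) = (x < y).
Proof. exact: ltcR. Qed.

Lemma toC_ge0 (x : R) : (0 <= toC x) = (0 <= x).
Proof. exact: (le_toC 0). Qed.

Lemma toC_gt0 (x : R) : (0 < toC x) = (0 < x).
Proof. exact: (lt_toC 0). Qed.

Lemma le_reC (z w : C) : z <= w -> reC z <= reC w.
Proof. by case: z w => [a b] [c d]; rewrite lecE => /andP[]. Qed.

Lemma lt_reC (z w : C) : z < w -> reC z < reC w.
Proof. by case: z w => [a b] [c d]; rewrite ltcE => /andP[]. Qed.

Lemma le_eq_imC (z w : C) : z <= w -> imC z = imC w.
Proof. by case: z w => [a b] [c d]; rewrite lecE => /andP[/eqP]. Qed.

Lemma reC_imC_le (z w : C) : reC z <= reC w -> imC z = imC w -> z <= w.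
Proof.
case: z w => [a b] [c d]; rewrite lecE/= /reC /imC/= => -> ->.
by rewrite eqxx.
Qed.

Lemma norm_reC_le (z : C) : `|reC z| <= reC `|z|.
Proof. by rewrite /reC normc_def/= -sqrtr_sqr ler_wsqrtr// lerDl sqr_ge0. Qed.

Lemma norm_imC_le (z : C) : `|imC z| <= reC `|z|.
Proof. by rewrite /reC normc_def/= -sqrtr_sqr ler_wsqrtr// lerDr sqr_ge0. Qed.

Lemma norm_le_reC_imC (z : C) : reC `|z| <= `|reC z| + `|imC z|.
Proof.
rewrite /reC /imC normc_def/= -[leRHS]ger0_norm ?addr_ge0//.
rewrite -[leRHS]sqrtr_sqr ler_wsqrtr// sqrrD !real_normK ?num_real//.
by rewrite addrAC lerDl mulrn_wge0// mulr_ge0.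
Qed.

Lemma cvg_contractive_additive (p : {additive C -> R}) s a :
  (forall z, `|p z| <= reC `|z|) ->
  s n @[n --> \oo] --> a -> p (s n) @[n --> \oo] --> p a.
Proof.
move=> p_le /cvgrPdist_lt sa; apply/cvgrPdist_lt => e e0.
have /sa : 0 < toC e by rewrite toC_gt0.
apply: filterS => n /lt_reC; rewrite -raddfB; apply: le_lt_trans.
exact: p_le.
Qed.

Lemma cvg_reC s a : s n @[n --> \oo] --> a -> reC (s n) @[n --> \oo] --> reC a.
Proof. exact: (cvg_contractive_additive norm_reC_le). Qed.

Lemma cvg_imC s a : s n @[n --> \oo] --> a -> imC (s n) @[n --> \oo] --> imC a.
Proof. exact: (cvg_contractive_additive norm_imC_le). Qed.

Lemma cvg_reC_imC s a : reC (s n) @[n --> \oo] --> reC a ->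
  imC (s n) @[n --> \oo] --> imC a -> s n @[n --> \oo] --> a.
Proof.
move=> /cvgrPdist_lt s_re /cvgrPdist_lt s_im; apply/cvgrPdist_lt => e e0.
have re_gt0 : 0 < reC e / 2 by rewrite divr_gt0// (lt_reC e0).
near=> n; rewrite -(ge0_reCK (normr_ge0 _)) -(ge0_reCK (ltW e0)) lt_toC.
apply: le_lt_trans (norm_le_reC_imC _) _; rewrite [ltRHS]splitr !raddfB.
by apply: ltrD; near: n; [exact: s_re|exact: s_im].
Unshelve. all: by end_near. Qed.

Lemma ler_cvgC s t a b : s n @[n --> \oo] --> a -> t n @[n --> \oo] --> b ->
  (\forall n \near \oo, s n <= t n) -> a <= b.
Proof.
move=> sa tb st; apply: reC_imC_le.
  apply: (ler_cvg_to (cvg_reC sa) (cvg_reC tb)).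
  by apply: filterS st => n; exact: le_reC.
have := cvg_imC tb; suff : imC (t n) @[n --> \oo] --> imC a.
  by move=> /(cvg_unique (@norm_hausdorff _ _)) ta /ta.
have := cvg_imC sa; apply: cvg_trans; apply: near_eq_cvg.
by apply: filterS st => n; exact: le_eq_imC.
Qed.

Lemma limC_le s a b : s n @[n --> \oo] --> a -> (forall n, s n <= b) -> a <= b.
Proof.
by move=> sa sb; apply: (ler_cvgC sa (cvg_cst b)); exact: nearW.
Qed.

Lemma limC_ge s a b : s n @[n --> \oo] --> a -> (forall n, b <= s n) -> b <= a.
Proof.
by move=> sa bs; apply: (ler_cvgC (cvg_cst b) sa); exact: nearW.
Qed.

Lemma nondecreasing_cvgC_le s a : (forall n m, (n <= m)%N -> s n <= s m) ->
  s n @[n --> \oo] --> a -> forall n, s n <= a.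
Proof.
move=> s_homo sa n; apply: (ler_cvgC (cvg_cst (s n)) sa).
by exists n => // m; exact: s_homo.
Qed.

Lemma nondecreasing_is_cvgC s b : (forall n m, (n <= m)%N -> s n <= s m) ->
  (forall n, s n <= b) -> cvgn s.
Proof.
move=> s_homo sb.
have re_cvg : cvgn (fun n => reC (s n)).
  apply: nondecreasing_is_cvgn => [n m nm|];
    first exact: le_reC (s_homo _ _ nm).
  by exists (reC b) => _ [n _ <-]; exact: le_reC.
apply: (cvgP (Complex (limn (fun n => reC (s n))) (imC (s 0%N)) : C)).
apply: cvg_reC_imC => //=; apply: cvg_near_cst; apply: nearW => n.
exact/esym/le_eq_imC/s_homo.
Qed.

Lemma dominated_real_is_cvg (s g : nat -> R) (b : R) :
  (forall n m, (n <= m)%N -> `|s m - s n| <= g m - g n) ->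
  (forall n, g n <= b) -> cvgn s.
Proof.
move=> sg gb; have g_cvg : cvgn g.
  apply: nondecreasing_is_cvgn => [n m nm|].
    by rewrite -subr_ge0; apply: le_trans (sg _ _ nm).
  by exists b => _ [n _ <-].
have -> : s = (s \+ g) \- g by apply/funext => n /=; rewrite addrK.
apply: is_cvgB g_cvg; apply: nondecreasing_is_cvgn => [n m nm|].
  by have := sg _ _ nm; rewrite ler_norml => /andP[+ _]; rewrite /=; lra.
exists (s 0%N - g 0%N + (b + b)) => _ [n _ <-] /=.
have := sg _ _ (leq0n n); rewrite ler_norml => /andP[_].
by have := gb n; lra.
Qed.

Lemma dominated_is_cvgC s g b :
  (forall n m, (n <= m)%N -> `|s m - s n| <= g m - g n) ->
  (forall n, g n <= b) -> cvgn s.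
Proof.
move=> sg gb.
have proj_cvg (p : {additive C -> R}) : (forall z, `|p z| <= reC `|z|) ->
    cvgn (fun n => p (s n)).
  move=> p_le; apply: (@dominated_real_is_cvg _ (@reC R \o g) (reC b)).
    move=> n m nm /=; rewrite -!raddfB.
    exact: le_trans (p_le _) (le_reC (sg _ _ nm)).
  by move=> n; exact: le_reC.
pose l : C := Complex (limn (fun n => reC (s n))) (limn (fun n => imC (s n))).
apply: (cvgP l).
apply: cvg_reC_imC; first exact: (proj_cvg _ norm_reC_le).
exact: (proj_cvg _ norm_imC_le).
Qed.

Lemma nbhs0_pos (P : C -> Prop) : (\forall z \near (0 : C), P z) ->
  exists2 e : C, 0 < e & forall z, `|z| <= e -> P z.
Proof.
move=> /nbhs_ballP[e /= e0 eP]; exists (e / 2); first by rewrite divr_gt0.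
move=> z ze; apply: eP; rewrite -ball_normE/= sub0r normrN.
by apply: le_lt_trans ze _; rewrite ltr_pdivrMr// ltr_pMr// ltr1n.
Qed.

End ComplexLimits.

(** * Newton's iteration *)

Section NewtonConvergence.
Variables (R : realType) (n : nat).
Local Notation C := (Cplx R).

Lemma cvg_of_halving (x : nat -> 'rV[C]_n) (l : 'rV[C]_n) :
  (forall k, `|x k.+1 - l| * 2 <= `|x k - l|) -> x k @[k --> \oo] --> l.
Proof.
move=> halving; set b := `|x 0%N - l|.
have dist_le k : `|x k - l| <= toC (geometric (reC b) 2^-1 k).
  rewrite /= rmorphM/= ge0_reCK ?normr_ge0// rmorphXn fmorphV rmorph_nat.
  elim: k => [|k IH]; first by rewrite expr0 mulr1.
  rewrite exprSr mulrA ler_pdivlMr ?ltr0n//; exact: le_trans (halving k) IH.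
apply/cvgrPdist_lt => e e0; have re_gt0 : 0 < reC e := lt_reC e0.
have /cvgrPdist_lt/(_ _ re_gt0) : geometric (reC b) 2^-1 k @[k --> \oo] --> 0.
  by apply: cvg_geometric; rewrite ger0_norm ?invr_ge0// invf_lt1// ltr1n.
apply: filterS => k; rewrite sub0r normrN => /(le_lt_trans (ler_norm _)) lt_e.
rewrite distrC -(ge0_reCK (ltW e0)); apply: le_lt_trans (dist_le k) _.
by rewrite lt_toC.
Qed.

Variables (F : 'rV[C]_n -> 'rV[C]_n) (L : 'rV[C]_n -> 'M[C]_n).
Variables (zeta : 'rV[C]_n) (d B : C).
Hypotheses (d_gt0 : 0 < d) (B_ge0 : 0 <= B) (F_zeta : F zeta = 0).
Hypotheses (F_approx : quad_approx F L zeta d B) (L_unit : L zeta \in unitmx).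

Let c : C := n%:R * `|invmx (L zeta)|.

Let c_ge0 : 0 <= c. Proof. by rewrite mulr_ge0. Qed.

Lemma L_zeta_expansive (e : 'rV[C]_n) : `|e| <= c * `|e *m L zeta|.
Proof. by rewrite -[X in `|X|](mulmxK L_unit e); exact: ler_norm_mulmx. Qed.

Definition newton_basin (x : 'rV[C]_n) : Prop :=
  `|x - zeta| + `|x - zeta| < d /\ 12%:R * (c * B) * `|x - zeta| <= 1.

Lemma newton_basin_ball : exists2 r, 0 < r &
  forall x, `|x - zeta| < r -> newton_basin x.
Proof.
have cB0 : 0 <= 12%:R * (c * B) by rewrite !mulr_ge0.
pose q := d^-1 * 2 + 12%:R * (c * B).
have q0 : 0 < q by rewrite ltr_wpDr// mulr_gt0// invr_gt0.
exists q^-1 => [|x xq]; first by rewrite invr_gt0.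
have {}xq : q * `|x - zeta| < 1.
  by rewrite -(ltr_pM2l q0) divff ?gt_eqF in xq.
split; last first.
  by apply: le_trans (ltW xq);
    rewrite ler_wpM2r// lerDr mulr_ge0// invr_ge0 ltW.
rewrite -(ltr_pM2l (x := d^-1)) ?invr_gt0// mulVf ?gt_eqF//.
apply: le_lt_trans xq; rewrite -mulr2n -mulr_natl mulrA ler_wpM2r//.
by rewrite lerDl.
Qed.

Lemma newton_basin_lt x : newton_basin x -> `|x - zeta| < d.
Proof. by case=> xd _; apply: le_lt_trans xd; rewrite lerDl. Qed.

Lemma newton_basin_expansive x (e : 'rV[C]_n) : newton_basin x ->
  `|e| <= 2 * c * `|e *m L x|.
Proof.
move=> [xd xB].
have eL_zeta : `|e *m L zeta| <= `|e *m L x| + 6%:R * B * `|x - zeta| * `|e|.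
  apply: le_trans (lerD (lexx _) (quad_approx_lipschitz B_ge0 F_approx e xd)).
  rewrite mulmxBr; apply: le_trans (ler_normB _ _).
  by rewrite opprB addrC subrK.
have e_le := le_trans (L_zeta_expansive e) (ler_wpM2l c_ge0 eL_zeta).
rewrite -(lerD2r `|e|) -[leLHS]mulr2n -[leLHS]mulr_natl.
apply: le_trans (ler_wpM2l (ler0n _ 2) e_le) _.
have -> : 2 * (c * (`|e *m L x| + 6%:R * B * `|x - zeta| * `|e|)) =
    2 * c * `|e *m L x| + 12%:R * (c * B) * `|x - zeta| * `|e| by ring.
by rewrite lerD2l -[leRHS]mul1r ler_wpM2r.
Qed.

Lemma newton_basin_unitmx x : newton_basin x -> 'J F x \in unitmx.
Proof.
move=> xB; rewrite (quad_approx_jacobian B_ge0 F_approx (newton_basin_lt xB)).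
apply: unitmx_of_injective => v vL; apply/eqP; rewrite -normr_le0.
by apply: le_trans (newton_basin_expansive v xB) _; rewrite vL normr0 mulr0.
Qed.

Lemma newton_step_dist x : newton_basin x ->
  `|newton_step F x - zeta| <= 2 * (c * B) * `|x - zeta| ^+ 2.
Proof.
move=> xB; have xd := newton_basin_lt xB.
apply: le_trans (newton_basin_expansive _ xB) _.
have -> : (newton_step F x - zeta) *m L x = F zeta - F x - (zeta - x) *m L x.
  have := newton_basin_unitmx xB; rewrite /newton_step.
  rewrite (quad_approx_jacobian B_ge0 F_approx xd) => Lx_unit.
  rewrite F_zeta addrAC mulmxBl mulmxKV// sub0r.
  by rewrite -[zeta - x]opprB mulNmx opprK [LHS]addrC.
rewrite -mulrA -[leRHS]mulrA ler_wpM2l// -[leRHS]mulrA ler_wpM2l//.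
rewrite -(distrC zeta x).
by apply: F_approx => //; rewrite subrr normr0.
Qed.

Lemma newton_step_halving x : newton_basin x ->
  `|newton_step F x - zeta| * 2 <= `|x - zeta|.
Proof.
move=> xB; apply: le_trans (ler_wpM2r (ler0n _ 2) (newton_step_dist xB)) _.
have [_] := xB; move: `|x - zeta| (normr_ge0 (x - zeta)) => r r0 rB.
have -> : 2 * (c * B) * r ^+ 2 * 2 = 4%:R * (c * B) * r * r by ring.
rewrite -[leRHS]mul1r ler_wpM2r//; apply: le_trans rB.
by rewrite ler_wpM2r// ler_wpM2r ?mulr_ge0// ler_nat.
Qed.

Lemma newton_quadratic (D : set 'rV[C]_n) : nbhs zeta D ->
  newton_cvg_quadratically_near F D zeta.
Proof.
move=> /nbhs_ballP[e /= e0 eD]; have [r r0 r_basin] := newton_basin_ball.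
pose W := ball zeta e `&` ball zeta r.
have W_basin x : W x -> newton_basin x.
  by case=> _; rewrite -ball_normE/= distrC; exact: r_basin.
have W_stable x : W x -> W (newton_step F x).
  move=> Wx; have xB := W_basin _ Wx.
  have closer : `|zeta - newton_step F x| <= `|zeta - x|.
    rewrite distrC [leRHS]distrC.
    apply: le_trans (newton_step_halving xB).
    by rewrite ler_peMr// ler1n.
  by case: Wx; rewrite /W -ball_normE; split; exact: le_lt_trans closer _.
exists W; first by apply: filterI; apply: nbhsx_ballx.
exists (reC (2 * (c * B))) => x0 Wx0 /=.
have Wx k : W (iter k (newton_step F) x0) by elim: k => //= k; exact: W_stable.
split=> [k||k].
- split; first by case: (Wx k) => /eD.
  exact: newton_basin_unitmx (W_basin _ (Wx k)).
- apply: cvg_of_halving => k /=.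
  exact: newton_step_halving (W_basin _ (Wx k)).
- rewrite ge0_reCK ?mulr_ge0//.
  exact: newton_step_dist (W_basin _ (Wx k)).
Qed.

End NewtonConvergence.

(** * Sums over boxes of multi-indices *)

Section BoxSums.
Variable n : nat.
Local Notation mi := {ffun 'I_n -> nat}.

Definition boxsum (V : nmodType) (f : mi -> V) (N : nat) : V :=
  \sum_(k : {ffun 'I_n -> 'I_N}) f [ffun i => val (k i)].

Lemma boxsum_sub (V : nmodType) (f : mi -> V) N M : (N <= M)%N ->
  boxsum f N = \sum_(k : {ffun 'I_n -> 'I_M} | [forall i, (k i < N)%N])
    f [ffun i => val (k i)].
Proof.
move=> NM.
pose widen (k : {ffun 'I_n -> 'I_N}) :=
  [ffun i => widen_ord NM (k i)].
have widen_inj : injective widen.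
  move=> k k' /ffunP kk'; apply/ffunP => i; apply: val_inj.
  by have /(congr1 val) := kk' i; rewrite !ffunE.
transitivity (\sum_(k in widen @: [set: {ffun 'I_n -> 'I_N}])
    f [ffun i => val (k i)]).
  rewrite big_imset/=; last by move=> k k' _ _; exact: widen_inj.
  rewrite /boxsum; apply: eq_big => [k|k _]; first by rewrite in_setT.
  by congr f; apply/ffunP => i; rewrite !ffunE.
apply: eq_bigl => k; apply/imsetP/forallP => [[k' _ ->] i|kN].
  by rewrite ffunE/=.
exists [ffun i => Ordinal (kN i)]; rewrite ?in_setT//.
by apply/ffunP => i; rewrite !ffunE; apply: val_inj.
Qed.

Lemma boxsum_split (V : nmodType) (f : mi -> V) N M : (N <= M)%N ->
  boxsum f M = boxsum f N +
    \sum_(k : {ffun 'I_n -> 'I_M} | ~~ [forall i, (k i < N)%N])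
      f [ffun i => val (k i)].
Proof.
move=> NM; rewrite (boxsum_sub f NM) /boxsum.
by rewrite (bigID (fun k : {ffun 'I_n -> 'I_M} => [forall i, (k i < N)%N])).
Qed.

Lemma eq_boxsum (V : nmodType) (f g : mi -> V) : f =1 g -> boxsum f =1 boxsum g.
Proof. by move=> fg N; apply: eq_bigr => k _. Qed.

Lemma boxsum_sum (V : nmodType) (I : finType) (F : I -> mi -> V) N :
  boxsum (fun k => \sum_i F i k) N = \sum_i boxsum (F i) N.
Proof. exact: exchange_big. Qed.

Lemma boxsumB (V : zmodType) (f g : mi -> V) N :
  boxsum (fun k => f k - g k) N = boxsum f N - boxsum g N.
Proof. exact: sumrB. Qed.

Lemma boxsumZ (K : pzRingType) c (f : mi -> K) N :
  boxsum (fun k => c * f k) N = c * boxsum f N.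
Proof. by rewrite /boxsum mulr_sumr. Qed.

Section Numeric.
Variable K : numDomainType.
Implicit Types f g : mi -> K.

Lemma boxsum_ge0 f N : (forall k, 0 <= f k) -> 0 <= boxsum f N.
Proof. by move=> f0; apply: sumr_ge0 => k _. Qed.

Lemma le_boxsum f g N : (forall k, f k <= g k) -> boxsum f N <= boxsum g N.
Proof. by move=> fg; apply: ler_sum => k _. Qed.

Lemma boxsum_homo f N M : (forall k, 0 <= f k) -> (N <= M)%N ->
  boxsum f N <= boxsum f M.
Proof. by move=> f0 NM; rewrite (boxsum_split f NM) lerDl sumr_ge0. Qed.

Lemma norm_boxsum_le f g N : (forall k, `|f k| <= g k) ->
  `|boxsum f N| <= boxsum g N.
Proof.
by move=> fg; apply: le_trans (ler_norm_sum _ _ _) _; apply: ler_sum => k _.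
Qed.

Lemma norm_boxsumB_le f g N M : (forall k, `|f k| <= g k) -> (N <= M)%N ->
  `|boxsum f M - boxsum f N| <= boxsum g M - boxsum g N.
Proof.
move=> fg NM; rewrite !(boxsum_split _ NM) ![_ + _ - _]addrAC !subrr !add0r.
by apply: le_trans (ler_norm_sum _ _ _) _; apply: ler_sum => k _.
Qed.

Lemma boxsum_ge_term f k0 : (forall k, 0 <= f k) -> exists N0,
  forall N, (N0 <= N)%N -> f k0 <= boxsum f N.
Proof.
move=> f0; exists (\sum_i k0 i).+1 => N N0.
have kN i : (k0 i < N)%N.
  by apply: leq_trans N0; rewrite ltnS (bigD1 i)//= leq_addr.
rewrite /boxsum (bigD1 [ffun i => Ordinal (kN i)])//=.
have -> : [ffun i => val ([ffun i => Ordinal (kN i)] i)] = k0.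
  by apply/ffunP => i; rewrite !ffunE.
by rewrite lerDl sumr_ge0.
Qed.

End Numeric.

Section Limits.
Variable R : realType.
Local Notation C := (Cplx R).
Implicit Types (f g : mi -> C) (B : C).

Lemma boxsum_le_lim f l : (forall k, 0 <= f k) ->
  boxsum f N @[N --> \oo] --> l -> forall N, boxsum f N <= l.
Proof.
by move=> f0; apply: nondecreasing_cvgC_le => N M; exact: boxsum_homo.
Qed.

Lemma boxsum_term_le_lim f k l : (forall k, 0 <= f k) ->
  boxsum f N @[N --> \oo] --> l -> f k <= l.
Proof.
move=> f0 fl; have [N0 f_le] := boxsum_ge_term k f0.
exact: le_trans (f_le _ (leqnn N0)) (boxsum_le_lim f0 fl N0).
Qed.

Lemma dominated_boxsum_is_cvg f g B : (forall k, `|f k| <= g k) ->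
  (forall N, boxsum g N <= B) -> cvgn (boxsum f).
Proof.
by move=> fg; apply: dominated_is_cvgC => N M; exact: norm_boxsumB_le.
Qed.

Lemma dominated_boxsum_le f g B l : (forall k, `|f k| <= g k) ->
  (forall N, boxsum g N <= B) -> boxsum f N @[N --> \oo] --> l -> `|l| <= B.
Proof.
move=> fg gB fl; apply: (limC_le (cvg_norm fl)) => N.
exact: le_trans (norm_boxsum_le N fg) (gB N).
Qed.

End Limits.
End BoxSums.

Section Monomials.
Variable n : nat.
Local Notation mi := {ffun 'I_n -> nat}.

Definition monomial (K : comPzRingType) (k : mi) (x : 'I_n -> K) : K :=
  \prod_i x i ^+ k i.

Definition dmonomial (K : comPzRingType) (k : mi) l (x : 'I_n -> K) : K :=
  (k l)%:R * x l ^+ (k l).-1 * \prod_(j | j != l) x j ^+ k j.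

(* The arguments of [P] are the value of a monomial at [x], its differential at
   [x] along [e], and its values at [y] and at [Y]. *)
Lemma monomial_ind (K : comNzRingType) (L M : comPzRingType)
    (P : K -> K -> L -> M -> Prop)
    (x e : 'I_n -> K) (y : 'I_n -> L) (Y : 'I_n -> M) :
  P 1 0 1 1 ->
  (forall a a' b A c c' d B, P a a' b A -> P c c' d B ->
     P (a * c) (a * c' + a' * c) (b * d) (A * B)) ->
  (forall i, P (x i) (e i) (y i) (Y i)) ->
  forall k, P (monomial k x) (\sum_l e l * dmonomial k l x)
              (monomial k y) (monomial k Y).
Proof.
move=> P1 PM Px k.
have P_power i j :
    P (x i ^+ j) (e i * (j%:R * x i ^+ j.-1)) (y i ^+ j) (Y i ^+ j).
  elim: j => [|j IH]; first by rewrite !expr0 mul0r mulr0.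
  rewrite !exprS; have := PM _ _ _ _ _ _ _ _ (Px i) IH.
  congr (P _ _ _ _); case: j {IH} => [|j].
    by rewrite /= !expr0 mul0r !mulr0 add0r !mulr1.
  by rewrite /= exprS -[j.+2%:R]natr1; ring.
have P_prod (s : seq 'I_n) : uniq s -> P (\prod_(i <- s) x i ^+ k i)
    (\sum_(l <- s) e l * ((k l)%:R * x l ^+ (k l).-1 *
       \prod_(j <- s | j != l) x j ^+ k j))
    (\prod_(i <- s) y i ^+ k i) (\prod_(i <- s) Y i ^+ k i).
  elim: s => [|i s IH]; first by rewrite !big_nil.
  move=> /= /andP[si /IH{}IH]; rewrite !big_cons eqxx/=.
  have := PM _ _ _ _ _ _ _ _ (P_power i (k i)) IH; congr (P _ _ _ _).
  rewrite addrC; congr (_ + _).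
    rewrite -!mulrA; do 3! congr (_ * _).
    rewrite [LHS]big_seq [RHS]big_seq_cond; apply: eq_bigl => j.
    by case: (boolP (j \in s)) => //= js; apply/esym/eqP => ji;
      rewrite -ji js in si.
  rewrite mulr_sumr !big_seq; apply: eq_bigr => l ls.
  have il : i != l by apply/eqP => il; rewrite il ls in si.
  by rewrite big_cons il; ring.
exact: P_prod (index_enum_uniq _).
Qed.

Lemma monomial_ge0 (K : numDomainType) k (x : 'I_n -> K) :
  (forall i, 0 <= x i) -> 0 <= monomial k x.
Proof. by move=> x0; apply: prodr_ge0 => i _; exact: exprn_ge0. Qed.

Lemma dmonomial_ge0 (K : numDomainType) k l (x : 'I_n -> K) :
  (forall i, 0 <= x i) -> 0 <= dmonomial k l x.
Proof.
move=> x0; rewrite !mulr_ge0 ?exprn_ge0//.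
by apply: prodr_ge0 => i _; exact: exprn_ge0.
Qed.

Lemma dmonomial_gt0 (K : numDomainType) (k : mi) l (x : 'I_n -> K) :
  (0 < k l)%N -> (forall i, 0 < x i) -> 0 < dmonomial k l x.
Proof.
move=> kl x0; rewrite !mulr_gt0 ?ltr0n ?exprn_gt0//.
by apply: prodr_gt0 => i _; exact: exprn_gt0.
Qed.

Lemma le_monomial (K : numDomainType) k (x y : 'I_n -> K) :
  (forall i, 0 <= x i) -> (forall i, x i <= y i) ->
  monomial k x <= monomial k y.
Proof.
move=> x0 xy; apply: ler_prod => i _; rewrite exprn_ge0//=.
by rewrite lerXn2r// nnegrE ?(le_trans (x0 i)).
Qed.

Lemma lt_monomial (K : numDomainType) (k : mi) (x y : 'I_n -> K) l :
  (0 < k l)%N -> (forall i, 0 < x i) -> (forall i, x i <= y i) -> x l < y l ->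
  monomial k x < monomial k y.
Proof.
move=> kl x0 xy xyl; rewrite /monomial (bigD1 l)//= [ltRHS](bigD1 l)//=.
apply: (@lt_le_trans _ _ (y l ^+ k l * \prod_(i | i != l) x i ^+ k i)).
  rewrite ltr_pM2r; last by apply: prodr_gt0 => i _; rewrite exprn_gt0.
  by rewrite ltrXn2r ?nnegrE ?ltW// ?(lt_trans (x0 l)) ?lt0n_neq0.
apply: ler_wpM2l.
  by rewrite exprn_ge0// (le_trans (ltW (x0 l))) ?ltW.
apply: ler_prod => i _; rewrite exprn_ge0/=; last by rewrite ltW.
by rewrite lerXn2r// nnegrE ltW// (lt_le_trans (x0 i)).
Qed.

Lemma norm_monomial (K : numDomainType) k (x : 'I_n -> K) :
  `|monomial k x| = monomial k (fun i => `|x i|).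
Proof.
by rewrite /monomial normr_prod; apply: eq_bigr => i _; rewrite normrX.
Qed.

Lemma horner_monomial (K : comNzRingType) k (P : 'I_n -> {poly K}) x :
  (monomial k P).[x] = monomial k (fun i => (P i).[x]).
Proof.
by rewrite /monomial horner_prod; apply: eq_bigr => i _; rewrite horner_exp.
Qed.

Lemma cvg_monomial (K : numFieldType) (s : nat -> 'I_n -> K) (q : 'I_n -> K) k :
  (forall i, s N i @[N --> \oo] --> q i) ->
  monomial k (s N) @[N --> \oo] --> monomial k q.
Proof.
move=> sq; apply: cvg_big => [|i _]; first exact: mul_continuous.
elim: (k i) => [|m IH]; first exact: cvg_cst.
by under eq_cvg do rewrite exprS; rewrite exprS; exact: cvgM (sq i) IH.
Qed.

Section QuadraticMajorant.
Variables (K : numFieldType) (th : K).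
Hypotheses (th_ge0 : 0 <= th) (th_le1 : th <= 1).

(* [A0 + A1 t + A2 t^2] majorizes, at the scale [th], the expansion
   [a + a' t + (b - a - a') t^2]. *)
Definition quad_major (a a' b A : K) : Prop := exists A0 A1 A2 : K,
  [/\ [/\ 0 <= A0, 0 <= A1 & 0 <= A2], A = A0 + A1 + A2 &
  [/\ `|a| <= A0, `|a'| <= th * A1 & `|b - a - a'| <= th ^+ 2 * A2]].

Lemma remainderM (a a' b c c' d : K) : b * d - a * c - (a * c' + a' * c) =
  a * (d - c - c') + (b - a - a') * c +
  (a' + (b - a - a')) * (c' + (d - c - c')).
Proof. by ring. Qed.

Lemma quad_majorM a a' b A c c' d B : quad_major a a' b A ->
  quad_major c c' d B -> quad_major (a * c) (a * c' + a' * c) (b * d) (A * B).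
Proof.
move=> [A0 [A1 [A2 [[A00 A10 A20] -> [aA a'A bA]]]]].
move=> [B0 [B1 [B2 [[B00 B10 B20] -> [cB c'B dB]]]]].
have th2 : th ^+ 2 <= th by rewrite expr2 ler_piMr.
have increment_le u v V1 V2 : 0 <= V2 ->
    `|u| <= th * V1 -> `|v| <= th ^+ 2 * V2 ->
    `|u + v| <= th * (V1 + V2).
  move=> V20 uV vV; apply: le_trans (ler_normD _ _) _; rewrite mulrDr lerD//.
  by apply: le_trans vV _; rewrite ler_wpM2r.
exists (A0 * B0), (A0 * B1 + A1 * B0),
  (A0 * B2 + A2 * B0 + (A1 + A2) * (B1 + B2)).
split; [by split; rewrite ?(mulr_ge0, addr_ge0)|ring|split].
- by rewrite normrM ler_pM.
- apply: le_trans (ler_normD _ _) _; rewrite mulrDr !normrM; apply: lerD.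
    by rewrite mulrCA ler_pM.
  by rewrite mulrA ler_pM.
- rewrite remainderM; apply: le_trans (ler_normD _ _) _.
  rewrite [leRHS]mulrDr; apply: lerD.
    apply: le_trans (ler_normD _ _) _.
    rewrite [leRHS]mulrDr !normrM; apply: lerD.
      by rewrite mulrCA ler_pM.
    by rewrite mulrA ler_pM.
  by rewrite normrM expr2 mulrACA ler_pM ?increment_le.
Qed.

Lemma monomial_quad_major (x e r d : 'I_n -> K) :
  (forall i, 0 <= d i) ->
  (forall i, `|x i| <= r i) -> (forall i, `|e i| <= th * d i) ->
  forall k, quad_major (monomial k x) (\sum_l e l * dmonomial k l x)
    (monomial k (fun i => x i + e i)) (monomial k (fun i => r i + d i)).
Proof.
move=> d0 xr ed; apply: monomial_ind.
- exists 1, 0, 0; rewrite !subr0 subrr normr0 normr1 !mulr0 !addr0.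
  by split; split.
- exact: quad_majorM.
- move=> i; exists (r i), (d i), 0.
  rewrite addr0 (addrC (x i)) addrK subrr normr0 mulr0.
  by split; split => //; rewrite ?(le_trans _ (xr i)).
Qed.

Lemma quad_major_bounds a a' b A : quad_major a a' b A ->
  `|a'| <= th * A /\ `|b - a - a'| <= th ^+ 2 * A.
Proof.
move=> [A0 [A1 [A2 [[A00 A10 A20] -> [aA a'A bA]]]]]; split.
  by apply: le_trans a'A _; rewrite ler_wpM2l// addrAC lerDr addr_ge0.
by apply: le_trans bA _; rewrite ler_wpM2l ?exprn_ge0// lerDr addr_ge0.
Qed.

Lemma norm_monomial_remainder_le (x e r d : 'I_n -> K) k :
  (forall i, 0 <= d i) ->
  (forall i, `|x i| <= r i) -> (forall i, `|e i| <= th * d i) ->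
  `|monomial k (fun i => x i + e i) - monomial k x -
      \sum_l e l * dmonomial k l x|
    <= th ^+ 2 * monomial k (fun i => r i + d i).
Proof.
by move=> d0 xr ed;
  have [] := quad_major_bounds (monomial_quad_major d0 xr ed k).
Qed.

End QuadraticMajorant.

Lemma norm_dmonomial_le (K : numFieldType) (x r d : 'I_n -> K) k l :
  (forall i, 0 <= d i) -> (forall i, `|x i| <= r i) ->
  `|d l * dmonomial k l x| <= monomial k (fun i => r i + d i).
Proof.
move=> d0 xr; pose e i := if i == l then d l else 0.
have ed i : `|e i| <= 1 * d i.
  rewrite mul1r /e; case: eqP => [->|_]; first by rewrite ger0_norm.
  by rewrite normr0.
have [+ _] := quad_major_bounds ler01
  (monomial_quad_major ler01 (lexx 1) d0 xr ed k).
rewrite mul1r (bigD1 l)//= big1 ?addr0; last first.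
  by move=> i il; rewrite /e (negbTE il) mul0r.
by rewrite /e eqxx.
Qed.

Lemma monomial_convex (K : numFieldType) (x e : 'I_n -> K) :
  (forall i, 0 <= x i) -> (forall i, 0 <= e i) -> forall k,
  0 <= monomial k (fun i => x i + e i) - monomial k x
       - \sum_l e l * dmonomial k l x.
Proof.
move=> x0 e0 k.
pose P (a a' b A : K) := [/\ 0 <= a, 0 <= a' & 0 <= b - a - a'].
suff [] : P (monomial k x) (\sum_l e l * dmonomial k l x)
  (monomial k (fun i => x i + e i)) (monomial k x) by [].
apply: monomial_ind => [|a a' b A c c' d B [a0 a'0 b0] [c0 c'0 d0]|i].
- by split; rewrite ?subrr.
- split; [by rewrite mulr_ge0|by rewrite addr_ge0 ?mulr_ge0|].
  by rewrite remainderM addr_ge0 ?mulr_ge0// addr_ge0 ?mulr_ge0// addr_ge0.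
- by split => //; rewrite (addrC (x i)) addrK subrr.
Qed.

End Monomials.

(** * Multivariate power series *)

Section PowerSeries.
Variables (R : realType) (n : nat).
Local Notation C := (Cplx R).
Implicit Types (a : mcoefs R n) (x y : 'rV[C]_n) (r s : 'I_n -> C).

Definition abs_bounded a r : Prop := exists B, forall N,
  boxsum (fun k => `|a k| * monomial k r) N <= B.

Definition mgrad a l x : C :=
  limn (boxsum (fun k => a k * dmonomial k l (x 0))).

Lemma mseriesE a x : mseries a x = boxsum (fun k => a k * monomial k (x 0)).
Proof.
apply/funext => N; apply: eq_bigr => k _; congr (_ * _).
by apply: eq_bigr => i _; rewrite ffunE.
Qed.

Lemma msumE a x : msum a x = limn (boxsum (fun k => a k * monomial k (x 0))).
Proof. by rewrite /msum mseriesE. Qed.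

Lemma abs_bounded_le a r s : (forall i, 0 <= r i) -> (forall i, r i <= s i) ->
  abs_bounded a s -> abs_bounded a r.
Proof.
move=> r0 rs [B aB]; exists B => N; apply: le_trans (aB N).
by apply: le_boxsum => k; rewrite ler_wpM2l ?le_monomial.
Qed.

Lemma abs_cvgP a x : abs_cvg a x <-> abs_bounded a (fun i => `|x 0 i|).
Proof.
rewrite /abs_cvg/= mseriesE; pose x_norm i := `|x 0 i|.
have -> : map_mx Num.norm x 0 = x_norm by apply/funext => i; rewrite mxE.
have term_ge0 k : 0 <= `|a k| * monomial k x_norm.
  by rewrite mulr_ge0 ?monomial_ge0// => i; exact: normr_ge0.
split=> [a_cvg|[B aB]]; last first.
  by apply: nondecreasing_is_cvgC aB => N M; exact: boxsum_homo.
by eexists; exact: boxsum_le_lim term_ge0 a_cvg.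
Qed.

Lemma abs_bounded_ge0 a x : (forall i, 0 <= x 0 i) -> abs_cvg a x ->
  abs_bounded a (x 0).
Proof.
move=> x0 /abs_cvgP; apply: abs_bounded_le => // i.
by rewrite ger0_norm.
Qed.

Lemma msum_cvg a r x : abs_bounded a r -> (forall i, `|x 0 i| <= r i) ->
  boxsum (fun k => a k * monomial k (x 0)) N @[N --> \oo] --> msum a x.
Proof.
move=> [B aB] xr; rewrite msumE; apply: dominated_boxsum_is_cvg aB => k.
by rewrite normrM norm_monomial ler_wpM2l// le_monomial.
Qed.

Lemma mgrad_cvg a r d x l : 0 < d -> abs_bounded a (fun i => r i + d) ->
  (forall i, `|x 0 i| <= r i) ->
  boxsum (fun k => a k * dmonomial k l (x 0)) N @[N --> \oo] --> mgrad a l x.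
Proof.
move=> d0 [B aB] xr; pose s i := r i + d.
apply: (@dominated_boxsum_is_cvg _ _ _ (fun k => d^-1 * (`|a k| * monomial k s))
  (d^-1 * B)) => [k|N]; last by rewrite boxsumZ ler_pM2l ?invr_gt0.
rewrite normrM mulrCA ler_wpM2l// mulrC ler_pdivlMr//.
rewrite -[X in _ * X](gtr0_norm d0) -normrM mulrC.
by apply: (norm_dmonomial_le k l _ xr) => i; exact: ltW.
Qed.

Lemma msum_remainder_cvg a r d x y : 0 < d ->
  abs_bounded a (fun i => r i + d) ->
  (forall i, `|x 0 i| <= r i) -> (forall i, `|y 0 i| <= r i + d) ->
  boxsum (fun k => a k * (monomial k (y 0) - monomial k (x 0)
             - \sum_l (y - x) 0 l * dmonomial k l (x 0))) N @[N --> \oo] -->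
  msum a y - msum a x - \sum_l (y - x) 0 l * mgrad a l x.
Proof.
move=> d0 aB xr yr.
have xr' i : `|x 0 i| <= r i + d by apply: le_trans (xr i) _; rewrite lerDl ltW.
have -> : boxsum (fun k => a k * (monomial k (y 0) - monomial k (x 0)
             - \sum_l (y - x) 0 l * dmonomial k l (x 0))) =
    (fun N => boxsum (fun k => a k * monomial k (y 0)) N
     - boxsum (fun k => a k * monomial k (x 0)) N
     - \sum_l (y - x) 0 l * boxsum (fun k => a k * dmonomial k l (x 0)) N).
  apply/funext => N; under [in RHS]eq_bigr do rewrite -boxsumZ.
  rewrite -boxsum_sum -!boxsumB; apply: eq_boxsum => k.
  rewrite !mulrBr mulr_sumr; congr (_ - _).
  by apply: eq_bigr => l _; rewrite mulrCA.
apply: cvgB; first exact: cvgB (msum_cvg aB yr) (msum_cvg aB xr').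
apply: cvg_big => [|l _]; first exact: add_continuous.
exact: cvgMl_tmp (mgrad_cvg d0 aB xr).
Qed.

Lemma msum_quad a r d B x y : 0 < d ->
  (forall N, boxsum (fun k => `|a k| * monomial k (fun i => r i + d)) N <= B) ->
  (forall i, `|x 0 i| <= r i) -> `|y - x| <= d ->
  `|msum a y - msum a x - \sum_l (y - x) 0 l * mgrad a l x|
    <= B / d ^+ 2 * `|y - x| ^+ 2.
Proof.
move=> d0 aB xr yxd; pose th := `|y - x| / d.
have th0 : 0 <= th by rewrite divr_ge0// ltW.
have th1 : th <= 1 by rewrite ler_pdivrMr// mul1r.
have yx i : `|(y - x) 0 i| <= th * d by rewrite divfK ?gt_eqF// ler_norm_entry.
have yE : y 0 = fun i => x 0 i + (y - x) 0 i.
  by apply/funext => i; rewrite !mxE [RHS]addrC subrK.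
have yr i : `|y 0 i| <= r i + d.
  rewrite yE; apply: le_trans (ler_normD _ _) _; rewrite lerD//.
  by apply: le_trans (ler_norm_entry _ _ _) yxd.
have -> : B / d ^+ 2 * `|y - x| ^+ 2 = th ^+ 2 * B.
  by rewrite /th expr_div_n mulrC [RHS]mulrAC mulrA.
pose s i := r i + d.
apply: (@dominated_boxsum_le _ _ _ (fun k => th ^+ 2 * (`|a k| * monomial k s)))
  (msum_remainder_cvg d0 (ex_intro _ B aB) xr yr) => [k|N].
  rewrite normrM mulrCA ler_wpM2l// [X in monomial k X - _]yE.
  by apply: (norm_monomial_remainder_le th0 th1 k _ xr) => // i; exact: ltW.
by rewrite boxsumZ ler_wpM2l ?exprn_ge0.
Qed.

Lemma nbhs_add_pos (A : set 'rV[C]_n) x : nbhs x A ->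
  exists2 d, 0 < d & A (x + const_mx d).
Proof.
move=> /nbhs_ballP[e /= e0 xe]; have e20 : 0 < e / 2 by rewrite divr_gt0.
exists (e / 2) => //; apply: xe.
rewrite -ball_normE/= opprD addrA subrr add0r normrN.
apply: le_lt_trans (_ : e / 2 < e);
  last by rewrite ltr_pdivrMr// ltr_pMr// ltr1n.
by apply: ler_mx_norm => [|i j]; rewrite ?mxE ?gtr0_norm// ltW.
Qed.

Lemma abs_cvg_add_pos a x d : (forall i, 0 <= x 0 i) -> 0 < d ->
  abs_cvg a (x + const_mx d) -> abs_bounded a (fun i => x 0 i + d).
Proof.
move=> x0 d0 /abs_bounded_ge0.
have -> : (x + const_mx d) 0 = fun i => x 0 i + d.
  by apply/funext => i; rewrite !mxE.
by apply=> i; rewrite addr_ge0// ltW.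
Qed.

Section NonnegativePoint.
Variables (a : mcoefs R n) (x : 'rV[C]_n).
Hypotheses (x_in : interior (abs_cvg a) x) (x_ge0 : forall i, 0 <= x 0 i).

Lemma interior_abs_bounded :
  exists2 d, 0 < d & abs_bounded a (fun i => x 0 i + d).
Proof.
by have [d d0 xd] := nbhs_add_pos x_in; exists d => //; exact: abs_cvg_add_pos.
Qed.

Lemma interior_mgrad_cvg l :
  boxsum (fun k => a k * dmonomial k l (x 0)) N @[N --> \oo] --> mgrad a l x.
Proof.
have [d d0 xd] := interior_abs_bounded; apply: (mgrad_cvg d0 xd) => i.
by rewrite ger0_norm.
Qed.

Hypothesis a_ge0 : forall k, 0 <= a k.

Lemma mgrad_ge0 l : 0 <= mgrad a l x.
Proof.
apply: limC_ge (@interior_mgrad_cvg l) _ => N.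
by apply: boxsum_ge0 => k; rewrite mulr_ge0 ?dmonomial_ge0.
Qed.

Lemma mgrad_gt0 l (k : {ffun 'I_n -> nat}) : (forall i, 0 < x 0 i) ->
  (0 < k l)%N -> a k != 0 -> 0 < mgrad a l x.
Proof.
move=> x0 kl ak.
apply: lt_le_trans (boxsum_term_le_lim k _ (@interior_mgrad_cvg l)).
  by rewrite mulr_gt0 ?dmonomial_gt0// lt_def ak a_ge0.
by move=> k'; rewrite mulr_ge0 ?dmonomial_ge0.
Qed.

Lemma msum_convex (w : 'rV[C]_n) : (forall i, 0 <= w 0 i) ->
  (forall i, w 0 i <= x 0 i) ->
  \sum_l (x - w) 0 l * mgrad a l w <= msum a x - msum a w.
Proof.
move=> w0 wx; have [d d0 xd] := interior_abs_bounded.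
have w_le i : `|w 0 i| <= x 0 i by rewrite ger0_norm.
have x_le i : `|x 0 i| <= x 0 i + d by rewrite ger0_norm// lerDl ltW.
rewrite -subr_ge0; apply: limC_ge (msum_remainder_cvg d0 xd w_le x_le) _ => N.
apply: boxsum_ge0 => k; rewrite mulr_ge0//.
have -> : x 0 = fun i => w 0 i + (x - w) 0 i.
  by apply/funext => i; rewrite !mxE [RHS]addrC subrK.
by apply: monomial_convex => // i; rewrite !mxE subr_ge0.
Qed.

End NonnegativePoint.

Lemma msum_lt a x y l (k : {ffun 'I_n -> nat}) : (forall k, 0 <= a k) ->
  (forall i, 0 < x 0 i) -> (forall i, x 0 i <= y 0 i) -> abs_cvg a y ->
  (0 < k l)%N -> a k != 0 -> x 0 l < y 0 l -> msum a x < msum a y.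
Proof.
move=> a0 x0 xy ay kl ak xyl.
have x0' i : 0 <= x 0 i by exact: ltW.
have y0 i : 0 <= y 0 i by exact: le_trans (xy i).
have aB := abs_bounded_ge0 y0 ay.
have diff_cvg : boxsum (fun k => a k * (monomial k (y 0) - monomial k (x 0))) N
    @[N --> \oo] --> msum a y - msum a x.
  under eq_cvg => N do rewrite (eq_boxsum (fun k => mulrBr _ _ _)) boxsumB.
  apply: cvgB; apply: msum_cvg aB _ => i; rewrite ger0_norm//.
rewrite -subr_gt0; apply: lt_le_trans (boxsum_term_le_lim k _ diff_cvg).
  by rewrite mulr_gt0 ?subr_gt0 ?(lt_monomial kl)// lt_def ak a0.
by move=> k'; rewrite mulr_ge0 ?subr_ge0 ?le_monomial.
Qed.

End PowerSeries.

Section SystemExpansion.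
Variables (R : realType) (m : nat) (h : system R m).
Local Notation C := (Cplx R).
Implicit Types (x y : 'rV[C]_(1 + m)).

Definition sysgrad x : 'M[C]_(1 + m, m) := \matrix_(l, j) mgrad (h j) l x.

Lemma sys_mapE x j : sys_map h x 0 j = msum (h j) x.
Proof. by rewrite mxE. Qed.

Lemma conv_dom_interior x j : conv_dom h x -> interior (abs_cvg (h j)) x.
Proof. by apply: filterS => y. Qed.

Lemma conv_dom_quad_approx x0 : conv_dom h x0 -> (forall i, 0 <= x0 0 i) ->
  exists d B : C, [/\ 0 < d, 0 <= B & quad_approx (sys_map h) sysgrad x0 d B].
Proof.
move=> /nbhs_add_pos[d d0 x0d] x00.
have [B hB] := choice (fun j => abs_cvg_add_pos x00 d0 (x0d j)).
have B0 j : 0 <= B j.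
  apply: le_trans (hB j 0%N); apply: boxsum_ge0 => k.
  by rewrite mulr_ge0// monomial_ge0// => i; rewrite addr_ge0// ltW.
have d20 : 0 < d / 2 by rewrite divr_gt0.
have d40 : 0 < d / 2 / 2 by rewrite divr_gt0.
have B_sum (j : 'I_m) : B j / (d / 2) ^+ 2 <= (\sum_i B i) / (d / 2) ^+ 2.
  by rewrite ler_pM2r ?invr_gt0 ?exprn_gt0// (bigD1 j)//= lerDl sumr_ge0.
have B_sum_ge0 : 0 <= (\sum_i B i) / (d / 2) ^+ 2.
  by rewrite divr_ge0 ?sumr_ge0// exprn_ge0// ltW.
exists (d / 2 / 2), ((\sum_i B i) / (d / 2) ^+ 2); split=> // x y xd yd.
have yx : `|y - x| <= d / 2.
  have -> : y - x = (y - x0) - (x - x0) by rewrite opprB addrA subrK.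
  by apply: le_trans (ler_normB _ _) _; rewrite (splitr (d / 2)) lerD// ltW.
have xr i : `|x 0 i| <= x0 0 i + d / 2.
  have -> : x 0 i = x0 0 i + (x - x0) 0 i by rewrite !mxE [RHS]addrC subrK.
  apply: le_trans (ler_normD _ _) _; rewrite ger0_norm// lerD2l.
  apply: le_trans (ler_norm_entry _ _ _) _; apply: le_trans (ltW xd) _.
  by rewrite [leRHS]splitr lerDl ltW.
apply: ler_mx_norm => [|i j]; first by rewrite mulr_ge0 ?exprn_ge0.
rewrite (ord1 i) !mxE.
under eq_bigr do rewrite [sysgrad _ _ _]mxE.
apply: le_trans (msum_quad d20 (B := B j) _ xr yx) _ => [N|].
  apply: le_trans (hB j N); apply: le_boxsum => k.
  rewrite ler_wpM2l// le_monomial// => l; first by rewrite !addr_ge0// ltW.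
  by rewrite -addrA -splitr.
by rewrite ler_wpM2r ?exprn_ge0.
Qed.

Lemma dHdUE x j l : conv_dom h x -> (forall i, 0 <= x 0 i) ->
  dHdU h x j l = mgrad (h j) (rshift 1 l) x.
Proof.
move=> xc x0; have [d [B [d0 B0 h_approx]]] := conv_dom_quad_approx xc x0.
by rewrite /dHdU (quad_approx_jacobian B0 h_approx) ?subrr ?normr0// !mxE.
Qed.

End SystemExpansion.

(** * Univariate power series *)

Section PowerSums.
Variable K : numDomainType.
Implicit Types (c g : nat -> K) (x y : K).

Definition powser c x N : K := \sum_(k < N) c k * x ^+ k.

Lemma powser1 c x : powser c x 1 = c 0%N.
Proof. by rewrite /powser big_ord1 expr0 mulr1. Qed.

Lemma powserS c x N :
  powser c x N.+1 = c 0%N + x * powser (fun k => c k.+1) x N.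
Proof.
rewrite /powser big_ord_recl expr0 mulr1 mulr_sumr; congr (_ + _).
by apply: eq_bigr => k _; rewrite exprS mulrCA.
Qed.

Lemma horner_poly_powser c x N : (\poly_(k < N) c k).[x] = powser c x N.
Proof. exact: horner_poly. Qed.

Lemma powserB c x y N :
  powser c y N - powser c x N = \sum_(k < N) c k * (y ^+ k - x ^+ k).
Proof. by rewrite -sumrB; apply: eq_bigr => k _; rewrite mulrBr. Qed.

Lemma powser_cat c x N M : (N <= M)%N ->
  powser c x M - powser c x N = \sum_(N <= k < M) c k * x ^+ k.
Proof.
move=> NM; rewrite /powser -!(big_mkord xpredT (fun k => c k * x ^+ k)).
by rewrite (@big_cat_nat _ _ _ N 0 M)//= addrAC subrr add0r.
Qed.

Lemma norm_term_le c g x y k : (forall k, `|c k| <= g k) -> `|x| <= y ->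
  `|c k * x ^+ k| <= g k * y ^+ k.
Proof.
move=> cg xy; rewrite normrM ler_pM// normrX lerXn2r ?nnegrE//.
exact: le_trans xy.
Qed.

Lemma norm_powser_le c g x y N : (forall k, `|c k| <= g k) -> `|x| <= y ->
  `|powser c x N| <= powser g y N.
Proof.
move=> cg xy; apply: le_trans (ler_norm_sum _ _ _) _.
by apply: ler_sum => k _; exact: norm_term_le.
Qed.

Lemma norm_powserB_le c g x y N M : (forall k, `|c k| <= g k) -> `|x| <= y ->
  (N <= M)%N -> `|powser c x M - powser c x N| <= powser g y M - powser g y N.
Proof.
move=> cg xy NM; rewrite !powser_cat//; apply: le_trans (ler_norm_sum _ _ _) _.
by apply: ler_sum => k _; exact: norm_term_le.
Qed.

Lemma powser_ge0 c x N : (forall k, 0 <= c k) -> 0 <= x -> 0 <= powser c x N.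
Proof.
by move=> c0 x0; apply: sumr_ge0 => k _; rewrite mulr_ge0 ?exprn_ge0.
Qed.

Lemma powser_homo c x N M : (forall k, 0 <= c k) -> 0 <= x -> (N <= M)%N ->
  powser c x N <= powser c x M.
Proof.
move=> c0 x0 NM; rewrite -subr_ge0 powser_cat// sumr_ge0// => k _.
by rewrite mulr_ge0 ?exprn_ge0.
Qed.

Lemma le_powser c x y N : (forall k, 0 <= c k) -> 0 <= x -> x <= y ->
  powser c x N <= powser c y N.
Proof.
move=> c0 x0 xy; apply: ler_sum => k _; rewrite ler_wpM2l// lerXn2r// nnegrE.
exact: le_trans xy.
Qed.

(* Beyond the degrees, [P.[x]] and [G.[y]] are themselves partial sums. *)
Lemma norm_horner_tail_le (P G : {poly K}) x y N :
  (forall k, `|P`_k| <= G`_k) -> `|x| <= y ->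
  `|P.[x] - powser (fun k => P`_k) x N| <= G.[y] - powser (fun k => G`_k) y N.
Proof.
move=> PG xy; set M := maxn N (maxn (size P) (size G)).
have PM : (size P <= M)%N by rewrite /M !leq_max leqnn orbT.
have GM : (size G <= M)%N by rewrite /M !leq_max leqnn !orbT.
rewrite (horner_coef_wide _ PM) (horner_coef_wide _ GM).
by apply: (norm_powserB_le PG xy); rewrite leq_maxl.
Qed.

End PowerSums.

Lemma geometric_sum_le (K : numFieldType) (q : K) N : 0 <= q -> q < 1 ->
  \sum_(k < N) q ^+ k <= (1 - q)^-1.
Proof.
move=> q0 q1; have q10 : 0 < 1 - q by rewrite subr_gt0.
rewrite -(ler_pM2l q10) divff ?gt_eqF// -opprB mulNr -subrX1 opprB.
by rewrite gerBl exprn_ge0.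
Qed.

(* By convexity of [z ^+ n], the chord slope on [x, y] is at most that on
   [r, s]. *)
Lemma exprB_le (K : numFieldType) (x y r s : K) n :
  0 <= x -> x <= y -> y <= r -> r < s ->
  y ^+ n - x ^+ n <= s ^+ n / (s - r) * (y - x).
Proof.
move=> x0 xy yr rs; have y0 := le_trans x0 xy; have r0 := le_trans y0 yr.
have s0 : 0 <= s by rewrite (le_trans r0)// ltW.
have sr : 0 < s - r by rewrite subr_gt0.
rewrite mulrAC ler_pdivlMr// mulrC.
apply: (@le_trans _ _ ((s ^+ n - r ^+ n) * (y - x))); last first.
  by rewrite ler_wpM2r ?subr_ge0// gerBl exprn_ge0.
rewrite !subrXX -!mulrA ler_pM2l// [leRHS]mulrC ler_wpM2l ?subr_ge0//.
apply: ler_sum => i _; apply: ler_pM; rewrite ?exprn_ge0// lerXn2r ?nnegrE//.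
  exact: le_trans yr (ltW rs).
exact: le_trans xy yr.
Qed.

Section ComplexPowerSeries.
Variable R : realType.
Local Notation C := (Cplx R).
Implicit Types (c : nat -> C) (x y : C).

Definition powsum c x : C := limn (powser c x).

Lemma series_powser c x : series (fun n => c n * x ^+ n) = powser c x.
Proof. by apply/funext => N; rewrite /series/= big_mkord. Qed.

Lemma powsum0 c : powsum c 0 = c 0%N.
Proof.
apply: (@lim_near_cst C) => //; exists 1%N => // -[|N]//= _.
by rewrite powserS mul0r addr0.
Qed.

Lemma powsum_const c x : (forall n, (0 < n)%N -> c n = 0) -> powsum c x = c 0%N.
Proof.
move=> c0; apply: (@lim_near_cst C) => //; exists 1%N => // -[|N]//= _.
by rewrite powserS /powser big1 ?mulr0 ?addr0// => k _; rewrite c0// mul0r.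
Qed.

Lemma powser_abs_bounded c x y : cvgn (powser c x) -> `|y| < `|x| ->
  exists B, forall N, powser (fun k => `|c k|) `|y| N <= B.
Proof.
rewrite -series_powser => /cvg_series_cvg_0 /cvgP /cvg_seq_bounded.
move=> /ex_strict_bound_gt0[B B0 cxB] yx.
have x0 : 0 < `|x| by apply: le_lt_trans yx.
pose q := `|y| / `|x|; have q0 : 0 <= q by rewrite divr_ge0.
have q1 : q < 1 by rewrite ltr_pdivrMr// mul1r.
exists (B * (1 - q)^-1) => N.
apply: le_trans (ler_wpM2l (ltW B0) (geometric_sum_le N q0 q1)).
rewrite mulr_sumr.
apply: ler_sum => k _; rewrite expr_div_n mulrA ler_pdivlMr;
  last exact: exprn_gt0.
rewrite mulrAC ler_wpM2r ?exprn_ge0//.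
by have /ltW := cxB k I; rewrite /= normrM normrX.
Qed.

Lemma powser_le_constant_add c x y N : (forall k, 0 <= c k) ->
  0 <= x -> x <= y -> 0 < y ->
  powser c x N.+1 <= c 0%N + x / y * powser c y N.+1.
Proof.
move=> c0 x0 xy y0; rewrite powserS lerD2l -mulrA ler_wpM2l// powserS mulrDr.
rewrite mulKf ?gt_eqF//; apply: (le_trans (le_powser N _ x0 xy)) => //.
by rewrite lerDr mulr_ge0// invr_ge0 ltW.
Qed.

Lemma powser_abs_le_near0 (I : finType) (c : I -> nat -> C) e d :
  0 < e -> 0 < d ->
  (forall i, cvgn (powser (c i) e)) -> exists e1, [/\ 0 < e1, e1 <= e &
    forall i x N, 0 <= x -> x <= e1 ->
      powser (fun k => `|c i k|) x N <= `|c i 0%N| + d].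
Proof.
move=> e0 d0 c_cvg; pose y := e / 2; have y0 : 0 < y by rewrite divr_gt0.
have ye : y < e by rewrite ltr_pdivrMr// ltr_pMr// ltr1n.
have [|B cB] := @choice _ _
  (fun i b => forall N, powser (fun k => `|c i k|) y N <= b).
  move=> i; have [|B cB] := @powser_abs_bounded (c i) e y (c_cvg i).
    by rewrite !gtr0_norm.
  by exists B; rewrite gtr0_norm// in cB.
have B0 i : 0 <= B i by apply: le_trans (cB i 0%N); rewrite /powser big_ord0.
have B_sum i : B i <= \sum_i B i by rewrite (bigD1 i)//= lerDl sumr_ge0.
have Bd0 : 0 < \sum_i B i + d by rewrite ltr_wpDl// sumr_ge0.
have ratio_le1 : d / (\sum_i B i + d) <= 1.
  by rewrite ler_pdivrMr// mul1r lerDr sumr_ge0.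
have e1y : y * (d / (\sum_i B i + d)) <= y by rewrite ler_piMr// ltW.
exists (y * (d / (\sum_i B i + d))); split=> [||i x N x0 xe1].
- by rewrite mulr_gt0// divr_gt0.
- exact: le_trans e1y (ltW ye).
case: N => [|N]; first by rewrite /powser big_ord0 addr_ge0// ltW.
apply: le_trans (powser_le_constant_add _ _ x0 (le_trans xe1 e1y) y0) _ => //.
rewrite lerD2l; apply: le_trans (_ : d / (\sum_i B i + d) * (\sum_i B i) <= _).
  apply: ler_pM; last exact: le_trans (cB i _) (B_sum i).
  - by rewrite divr_ge0// ltW.
  - by apply: powser_ge0 => [k|]; [exact: normr_ge0|exact: ltW].
  - by rewrite ler_pdivrMr// mulrC.
by rewrite mulrAC ler_pdivrMr// ler_wpM2l ?lerDl// ltW.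
Qed.

Lemma powser_cvg0_coef0 c e : 0 < e ->
  (forall x, 0 < x -> x <= e -> powser c x N @[N --> \oo] --> 0) -> c 0%N = 0.
Proof.
move=> e0 c_cvg0; pose y := e / 2; have y0 : 0 < y by rewrite divr_gt0.
have ye : y < e by rewrite ltr_pdivrMr// ltr_pMr// ltr1n.
have [||B cB] := @powser_abs_bounded c e y.
- exact: cvgP (c_cvg0 e e0 (lexx e)).
- by rewrite !gtr0_norm.
rewrite gtr0_norm// in cB; pose b k : C := `|c k|.
have c0_le (t : C) : 0 < t -> t <= 1 -> `|c 0%N| <= t * B.
  move=> t0 t1; have ty0 : 0 < t * y by rewrite mulr_gt0.
  have ty : t * y <= y by rewrite -[leRHS]mul1r ler_wpM2r// ltW.
  have lim_ty := c_cvg0 _ ty0 (le_trans ty (ltW ye)).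
  have lim_c0 : `|powser c (t * y) N - c 0%N| @[N --> \oo] --> `|0 - c 0%N|.
    exact: cvg_norm (cvgB lim_ty (cvg_cst _)).
  rewrite -normrN -sub0r; apply: (ler_cvgC lim_c0 (cvg_cst _)).
  exists 1%N => // -[|N]//= _; rewrite -(powser1 c (t * y)).
  apply: le_trans (@norm_powserB_le _ c b _ (t * y) _ _ _ _ _) _ => //.
    by rewrite gtr0_norm.
  rewrite powser1 lerBlDl.
  apply: le_trans (powser_le_constant_add _ _ (ltW ty0) ty y0) _.
    by move=> k; exact: normr_ge0.
  by rewrite mulfK ?gt_eqF// lerD2l ler_wpM2l// ltW.
apply/eqP; rewrite -normr_eq0; apply: contraT => c0N0.
have c0_gt0 : 0 < `|c 0%N| by rewrite lt_def c0N0 normr_ge0.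
have := c0_le _ ltr01 (lexx 1); rewrite mul1r => c0B.
have B0 : 0 < B by apply: lt_le_trans c0B.
have : `|c 0%N| <= `|c 0%N| / 2.
  have := c0_le (`|c 0%N| / 2 / B); rewrite divfK ?gt_eqF//; apply.
    by rewrite !divr_gt0.
  rewrite ler_pdivrMr// mul1r (le_trans _ c0B)// ler_pdivrMr//.
  by rewrite ler_peMr ?ler1n// ltW.
by rewrite ler_pdivlMr// ger_pMr// lern1.
Qed.

Lemma powser_cvg0_eq0 c e : 0 < e ->
  (forall x, 0 < x -> x <= e -> powser c x N @[N --> \oo] --> 0) ->
  forall n, c n = 0.
Proof.
move=> e0 c_cvg0 n; elim: n c c_cvg0 => [|n IH] c c_cvg0.
  exact: powser_cvg0_coef0 c_cvg0.
have c00 := powser_cvg0_coef0 e0 c_cvg0.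
apply: (IH (fun k => c k.+1)) => x x0 xe.
have -> : powser (fun k => c k.+1) x = fun N => x^-1 * powser c x N.+1.
  by apply/funext => N; rewrite powserS c00 add0r mulKf ?gt_eqF.
rewrite -(mulr0 x^-1); apply: cvgMl_tmp; have := c_cvg0 x x0 xe.
by rewrite -(cvg_shiftS (powser c x)).
Qed.

Lemma powser_lim_inj c c' e (f : C -> C) : 0 < e ->
  (forall x, 0 < x -> x <= e -> powser c x N @[N --> \oo] --> f x) ->
  (forall x, 0 < x -> x <= e -> powser c' x N @[N --> \oo] --> f x) ->
  forall n, c n = c' n.
Proof.
move=> e0 cf c'f n; pose b k := c k - c' k.
suff bn : b n = 0 by apply/eqP; rewrite -subr_eq0 -bn.
apply: (powser_cvg0_eq0 e0) => x x0 xe.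
have -> : powser b x = powser c x \- powser c' x.
  apply/funext => N /=; rewrite /powser -sumrB; apply: eq_bigr => k _.
  by rewrite mulrBl.
by rewrite -(subrr (f x)); exact: cvgB (cf x x0 xe) (c'f x x0 xe).
Qed.

Section NonnegativeCoefficients.
Variable c : nat -> C.
Hypothesis c_ge0 : forall k, 0 <= c k.

Lemma powser_le_powsum x N : 0 <= x -> cvgn (powser c x) ->
  powser c x N <= powsum c x.
Proof.
by move=> x0 cx; apply: nondecreasing_cvgC_le cx _ => n k; exact: powser_homo.
Qed.

Lemma powsum_ge0 x : 0 <= x -> cvgn (powser c x) -> 0 <= powsum c x.
Proof. by move=> x0 /(powser_le_powsum 0 x0); rewrite /powser big_ord0. Qed.

Lemma powsum_gt0 x n : 0 < x -> cvgn (powser c x) -> 0 < c n -> 0 < powsum c x.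
Proof.
move=> x0 cx cn; have x0' := ltW x0.
apply: lt_le_trans (powser_le_powsum n.+1 x0' cx).
by rewrite /powser big_ord_recr/= ltr_wpDl ?powser_ge0// mulr_gt0// exprn_gt0.
Qed.

Lemma cvg_powser_le x y : cvgn (powser c y) -> 0 <= x -> x <= y ->
  cvgn (powser c x).
Proof.
move=> cy x0 xy; apply: (@nondecreasing_is_cvgC _ _ (powsum c y)) => [n k|N].
  exact: powser_homo.
exact: le_trans (le_powser N c_ge0 x0 xy)
  (powser_le_powsum N (le_trans x0 xy) cy).
Qed.

Lemma powsumB_ge_term x y n : cvgn (powser c y) -> 0 <= x -> x <= y ->
  c n * (y ^+ n - x ^+ n) <= powsum c y - powsum c x.
Proof.
move=> cy x0 xy; have cx := cvg_powser_le cy x0 xy.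
apply: (ler_cvgC (cvg_cst _) (cvgB cy cx)); exists n.+1 => // N /= nN.
rewrite [leRHS]powserB (bigD1 (Ordinal nN))//= lerDl sumr_ge0// => k _.
by rewrite mulr_ge0// subr_ge0 lerXn2r// nnegrE (le_trans x0).
Qed.

Lemma le_powsum x y : cvgn (powser c y) -> 0 <= x -> x <= y ->
  powsum c x <= powsum c y.
Proof.
move=> cy x0 xy; rewrite -subr_ge0.
apply: le_trans (powsumB_ge_term 0 cy x0 xy).
by rewrite !expr0 subrr mulr0.
Qed.

Lemma lt_powsum x y n : cvgn (powser c y) -> 0 <= x -> x < y -> (0 < n)%N ->
  0 < c n -> powsum c x < powsum c y.
Proof.
move=> cy x0 xy n0 cn; have y0 := le_lt_trans x0 xy.
rewrite -subr_gt0; apply: lt_le_trans (powsumB_ge_term n cy x0 (ltW xy)).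
by rewrite mulr_gt0// subr_gt0 ltrXn2r ?nnegrE ?(ltW y0) -?lt0n.
Qed.

Lemma powsum_lipschitz x y r s : cvgn (powser c s) -> 0 <= x -> x <= y ->
  y <= r -> r < s -> powsum c y - powsum c x <= powsum c s / (s - r) * (y - x).
Proof.
move=> cs x0 xy yr rs; have ys := le_trans yr (ltW rs).
have cy := cvg_powser_le cs (le_trans x0 xy) ys.
have cx := cvg_powser_le cy x0 xy.
apply: (limC_le (cvgB cy cx)) => N; rewrite [leLHS]powserB.
have sr : 0 < s - r by rewrite subr_gt0.
apply: le_trans (_ : powser c s N / (s - r) * (y - x) <= _).
  rewrite /powser -mulrA mulr_suml; apply: ler_sum => k _.
  by rewrite -mulrA ler_wpM2l// mulrA exprB_le.
rewrite ler_wpM2r ?subr_ge0// ler_pM2r ?invr_gt0//.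
exact: powser_le_powsum (le_trans (le_trans x0 xy) ys) cs.
Qed.

End NonnegativeCoefficients.
End ComplexPowerSeries.

(** * Substitution of power series *)

Section MonomialCoefficients.
Variable n : nat.
Local Notation mi := {ffun 'I_n -> nat}.

Definition poly_trunc (K : nzSemiRingType) (Q : 'I_n -> nat -> K) N (i : 'I_n) :
  {poly K} := \poly_(l < N) Q i l.

(* The coefficient of [z ^ p] in the product of the powers of the series
   [sum_l Q i l z ^ l], which their terms beyond degree [p] do not affect. *)
Definition monomial_coef (K : comNzRingType) (k : mi) (Q : 'I_n -> nat -> K)
  (p : nat) : K := (monomial k (poly_trunc Q p.+1))`_p.

Lemma monomial_ind2 (L M : comPzRingType) (P : L -> M -> Prop)
    (x : 'I_n -> L) (y : 'I_n -> M) (k : mi) : P 1 1 ->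
  (forall a b c d, P a b -> P c d -> P (a * c) (b * d)) ->
  (forall i, P (x i) (y i)) -> P (monomial k x) (monomial k y).
Proof.
move=> P1 PM Pxy.
apply: (@monomial_ind n int L M (fun _ _ => P) (fun=> 0) (fun=> 0)) => //.
by move=> a a' b A c c' d B; exact: PM.
Qed.

Lemma eq_coef_monomial (K : comNzRingType) (P Q : 'I_n -> {poly K}) k p :
  (forall i l, (l <= p)%N -> (P i)`_l = (Q i)`_l) ->
  (monomial k P)`_p = (monomial k Q)`_p.
Proof.
move=> PQ; pose agree (f g : {poly K}) := forall l, (l <= p)%N -> f`_l = g`_l.
suff : agree (monomial k P) (monomial k Q) by apply.
apply: monomial_ind2 => // f g u v fg uv l lp; rewrite !coefM.
apply: eq_bigr => j _; congr (_ * _); [apply: fg|apply: uv].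
  by apply: leq_trans lp; rewrite -ltnS.
by apply: leq_trans lp; exact: leq_subr.
Qed.

Lemma coef_monomial_trunc (K : comNzRingType) (Q : 'I_n -> nat -> K) k N p :
  (p < N)%N -> (monomial k (poly_trunc Q N))`_p = monomial_coef k Q p.
Proof.
move=> pN; apply: eq_coef_monomial => i l lp.
by rewrite !coef_poly ltnS lp (leq_ltn_trans lp pN).
Qed.

Lemma norm_coef_monomial_le (K : numDomainType) (P G : 'I_n -> {poly K}) k p :
  (forall i l, `|(P i)`_l| <= (G i)`_l) ->
  `|(monomial k P)`_p| <= (monomial k G)`_p.
Proof.
move=> PG; move: p.
pose dominated (f g : {poly K}) := forall p, `|f`_p| <= g`_p.
apply: (@monomial_ind2 _ _ dominated) => // [p|f g u v fg uv p].
  by rewrite coef1 normr_nat.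
rewrite !coefM; apply: le_trans (ler_norm_sum _ _ _) _.
by apply: ler_sum => j _; rewrite normrM ler_pM.
Qed.

Lemma norm_coef_trunc_le (K : numDomainType) (Q G : 'I_n -> nat -> K) N M i l :
  (N <= M)%N -> (forall i l, `|Q i l| <= G i l) ->
  `|(poly_trunc Q N i)`_l| <= (poly_trunc G M i)`_l.
Proof.
move=> NM QG; rewrite !coef_poly; case: ltnP => [lN|_].
  by rewrite (leq_trans lN NM).
by rewrite normr0; case: ifP => // _; apply: le_trans (QG i l).
Qed.

Lemma norm_monomial_coef_le (K : numDomainType) (Q G : 'I_n -> nat -> K) k p :
  (forall i l, `|Q i l| <= G i l) ->
  `|monomial_coef k Q p| <= monomial_coef k G p.
Proof.
by move=> QG; apply: norm_coef_monomial_le => i l; exact: norm_coef_trunc_le.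
Qed.

(* Modulo [z ^ (p + 1)], raising the series [Q i] to the powers [k i] is affine
   in the coefficients [Q i p], with the differential of the monomial at the
   constant terms as linear part. *)
Lemma monomial_coef_split (K : comNzRingType) (k : mi)
    (Q : 'I_n -> nat -> K) p :
  (0 < p)%N -> monomial_coef k Q p = (monomial k (poly_trunc Q p))`_p +
    \sum_l Q l p * dmonomial k l (fun i => Q i 0%N).
Proof.
case: p => // p _; set x := fun i => Q i 0%N; set e := fun l => Q l p.+1.
pose expansion (a a' : K) (f g : {poly K}) :=
  exists u v : {poly K}, f = a%:P + 'X * u /\
  g = f + a'%:P * 'X^(p.+1) + 'X^(p.+2) * v.
suff [u [v [_]]] : expansion (monomial k x) (\sum_l e l * dmonomial k l x)
    (monomial k (poly_trunc Q p.+1)) (monomial k (poly_trunc Q p.+2)).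
  rewrite /monomial_coef => ->; rewrite !coefD coefMXn ltnn subnn coefC eqxx.
  by rewrite mulrC coefMXn ltnSn addr0.
apply: monomial_ind => [|a a' f g c c' r s|i].
- by exists 0, 0; rewrite !mulr0 mul0r !addr0.
- move=> [u [v [fE gE]]] [u' [v' [rE sE]]].
  exists (u * r + a%:P * u'), (c'%:P * u + a'%:P * u' + 'X^p * (a'%:P * c'%:P)
    + v * s + v' * (f + a'%:P * 'X^(p.+1))).
  rewrite gE sE fE rE !exprS !polyCD !polyCM; split; ring.
- exists (\poly_(l < p) Q i l.+1), 0; rewrite mulr0 addr0; split.
    apply/polyP => l; rewrite /poly_trunc coefD coefXM coefC !coef_poly.
    by case: l => [|l]; rewrite ?addr0//= add0r ltnS.
  apply/polyP => l; rewrite /poly_trunc coefD coefCM coefXn !coef_poly !ltnS.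
  rewrite leq_eqVlt ltnS; case: eqVneq => [->|_].
    by rewrite ltnn mulr1 add0r.
  by rewrite mulr0 addr0.
Qed.

End MonomialCoefficients.

Section DoubleLimits.
Variable R : realType.
Local Notation C := (Cplx R).

Lemma squeeze_cvg0 (s g : nat -> C) : (forall n, `|s n| <= g n) ->
  g n @[n --> \oo] --> 0 -> s n @[n --> \oo] --> 0.
Proof.
move=> sg /cvgr0Pnorm_lt g0; apply/cvgr0Pnorm_lt => e /g0; apply: filterS => n.
apply: le_lt_trans; rewrite [leRHS]ger0_norm//; exact: le_trans (sg n).
Qed.

Definition dominated_double (T S : nat -> nat -> C) : Prop :=
  forall N M L K, (N <= M)%N -> (L <= K)%N ->
    `|T M K - T N L| <= S M K - S N L.

Lemma dominated_double_row (T S : nat -> nat -> C) (F : nat -> C) B :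
  dominated_double T S -> (forall N L, S N L <= B) ->
  (forall N, T N L @[L --> \oo] --> F N) ->
  F N - T N N @[N --> \oo] --> 0.
Proof.
move=> TS SB TF; pose S_diag N := S N N.
have S_homo N M L K : (N <= M)%N -> (L <= K)%N -> S N L <= S M K.
  by move=> NM LK; rewrite -subr_ge0; apply: le_trans (TS _ _ _ _ NM LK).
have S_cvg : cvgn S_diag.
  apply: (@nondecreasing_is_cvgC _ _ B) => [N M NM|N]; last exact: SB.
  exact: S_homo.
have S_le N L : S N L <= limn S_diag.
  apply: le_trans (S_homo N (maxn N L) L _ (leq_maxl _ _) (leq_maxr _ _)) _.
  by apply: nondecreasing_cvgC_le S_cvg _ => M K MK; exact: S_homo.
have F_dist N : `|F N - T N N| <= limn S_diag - S_diag N.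
  apply: (ler_cvgC (cvg_norm (cvgB (TF N) (cvg_cst (T N N)))) (cvg_cst _)).
  exists N => // L /= NL; apply: le_trans (TS _ _ _ _ (leqnn N) NL) _.
  by rewrite lerD2r.
apply: squeeze_cvg0 F_dist _; rewrite -(subrr (limn S_diag)).
exact: cvgB (cvg_cst _) S_cvg.
Qed.

(* Both iterated limits agree with the limit along the diagonal. *)
Lemma dominated_double_exchange (T S : nat -> nat -> C) (F G : nat -> C)
    (B f : C) :
  dominated_double T S -> (forall N L, S N L <= B) ->
  (forall N, T N L @[L --> \oo] --> F N) ->
  (forall L, T N L @[N --> \oo] --> G L) ->
  F N @[N --> \oo] --> f -> G L @[L --> \oo] --> f.
Proof.
move=> TS SB TF TG Ff.
have F_diag : F N - T N N @[N --> \oo] --> 0.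
  exact: dominated_double_row TS SB TF.
have TS' : dominated_double (fun L N => T N L) (fun L N => S N L).
  by move=> N M L K NM LK; exact: TS.
have G_diag : G N - T N N @[N --> \oo] --> 0.
  exact: dominated_double_row TS' (fun L N => SB N L) TG.
have -> : G = F \- ((fun N => F N - T N N) \- (fun N => G N - T N N)).
  by apply/funext => N /=; ring.
by rewrite -[f]subr0 -[0]subr0; apply: cvgB Ff (cvgB F_diag G_diag).
Qed.

End DoubleLimits.

Section MonomialSeries.
Variables (R : realType) (n : nat).
Local Notation C := (Cplx R).
Implicit Types (k : {ffun 'I_n -> nat}) (Q : 'I_n -> nat -> C)
  (q g : 'I_n -> C).

Lemma horner_monomial_trunc k Q N x :
  (monomial k (poly_trunc Q N)).[x] = monomial k (fun i => powser (Q i) x N).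
Proof.
rewrite horner_monomial; congr monomial; apply/funext => i.
exact: horner_poly_powser.
Qed.

Lemma powser_coef_monomial_trunc k Q N x :
  powser (fun p => (monomial k (poly_trunc Q N))`_p) x N =
  powser (monomial_coef k Q) x N.
Proof. by apply: eq_bigr => p _; rewrite coef_monomial_trunc. Qed.

Lemma dist_monomial_powser_le k Q G x y N : (forall i l, `|Q i l| <= G i l) ->
  `|x| <= y ->
  `|monomial k (fun i => powser (Q i) x N) - powser (monomial_coef k Q) x N| <=
  monomial k (fun i => powser (G i) y N) - powser (monomial_coef k G) y N.
Proof.
move=> QG xy; rewrite -!horner_monomial_trunc -!powser_coef_monomial_trunc.
apply: norm_horner_tail_le => // p.
by apply: norm_coef_monomial_le => i l; exact: norm_coef_trunc_le.
Qed.

Lemma cvg_monomial_powser k Q x q :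
  (forall i, powser (Q i) x N @[N --> \oo] --> q i) ->
  monomial k (fun i => powser (Q i) x N) @[N --> \oo] --> monomial k q.
Proof.
by move=> Qq; exact: (cvg_monomial (s := fun N i => powser (Q i) x N) Qq).
Qed.

Section Nonnegative.
Variables (k : {ffun 'I_n -> nat}) (G : 'I_n -> nat -> C) (y : C).
Hypotheses (G_ge0 : forall i l, 0 <= G i l) (y_ge0 : 0 <= y).

Lemma monomial_coef_ge0 p : 0 <= monomial_coef k G p.
Proof.
have G_norm i l : `|G i l| <= G i l by rewrite ger0_norm.
exact: le_trans (normr_ge0 _) (norm_monomial_coef_le k p G_norm).
Qed.

Lemma powser_monomial_coef_le N :
  powser (monomial_coef k G) y N <= monomial k (fun i => powser (G i) y N).
Proof.
rewrite -subr_ge0.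
apply: le_trans (normr_ge0 _) (dist_monomial_powser_le _ _ _ _).
  by move=> i l; rewrite ger0_norm.
by rewrite ger0_norm.
Qed.

Lemma monomial_powser_le N : exists M,
  monomial k (fun i => powser (G i) y N) <= powser (monomial_coef k G) y M.
Proof.
set P := monomial k (poly_trunc G N); exists (size P).
rewrite -horner_monomial_trunc horner_coef; apply: ler_sum => p _.
rewrite ler_wpM2r ?exprn_ge0// -(coef_monomial_trunc _ _ (leq_maxr N p.+1)).
have trunc_le M i l : (N <= M)%N ->
    `|(poly_trunc G N i)`_l| <= (poly_trunc G M i)`_l.
  by move=> NM; apply: norm_coef_trunc_le NM _ => i' l'; rewrite ger0_norm.
have P_norm : `|P`_p| <= P`_p.
  by apply: norm_coef_monomial_le => i l; exact: trunc_le.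
rewrite -(ger0_norm (le_trans (normr_ge0 _) P_norm)).
by apply: norm_coef_monomial_le => i l; apply: trunc_le; exact: leq_maxl.
Qed.

Lemma nonneg_monomial_powser_cvg (g : 'I_n -> C) :
  (forall i, powser (G i) y N @[N --> \oo] --> g i) ->
  powser (monomial_coef k G) y N @[N --> \oo] --> monomial k g.
Proof.
move=> Gg.
have coef_homo N M : (N <= M)%N ->
    powser (monomial_coef k G) y N <= powser (monomial_coef k G) y M.
  by apply: powser_homo => // p; exact: monomial_coef_ge0.
have coef_le N : powser (monomial_coef k G) y N <= monomial k g.
  apply: le_trans (powser_monomial_coef_le N) _; apply: le_monomial => i.
    exact: powser_ge0.
  by apply: nondecreasing_cvgC_le (Gg i) _ => M L; exact: powser_homo.
have coef_cvg := nondecreasing_is_cvgC coef_homo coef_le.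
suff -> : monomial k g = limn (powser (monomial_coef k G) y) by [].
apply/eqP; rewrite eq_le (limC_le coef_cvg coef_le) andbT.
apply: (limC_le (cvg_monomial_powser Gg)) => N.
have [M NM] := monomial_powser_le N.
exact: le_trans NM (nondecreasing_cvgC_le coef_homo coef_cvg M).
Qed.

End Nonnegative.

Lemma monomial_powser_cvg k Q x q g :
  (forall i, powser (Q i) x N @[N --> \oo] --> q i) ->
  (forall i N, powser (fun l => `|Q i l|) `|x| N <= g i) ->
  powser (monomial_coef k Q) x N @[N --> \oo] --> monomial k q.
Proof.
move=> Qq Qg; pose G i l : C := `|Q i l|.
have G0 i l : 0 <= G i l by exact: normr_ge0.
have G_cvg i : cvgn (powser (G i) `|x|).
  by apply: nondecreasing_is_cvgC (Qg i) => N M; exact: powser_homo.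
pose mono (S : 'I_n -> nat -> C) z N := monomial k (fun i => powser (S i) z N).
have diff_cvg : mono Q x N - powser (monomial_coef k Q) x N @[N --> \oo] --> 0.
  pose majorant := mono G `|x| \- powser (monomial_coef k G) `|x|.
  apply: (@squeeze_cvg0 _ _ majorant) => [N|].
    exact: dist_monomial_powser_le.
  rewrite -(subrr (monomial k (fun i => limn (powser (G i) `|x|)))).
  apply: cvgB; first exact: cvg_monomial_powser.
  exact: nonneg_monomial_powser_cvg.
have -> : powser (monomial_coef k Q) x =
    mono Q x \- (fun N => mono Q x N - powser (monomial_coef k Q) x N).
  by apply/funext => N /=; rewrite opprB addrCA subrr addr0.
by rewrite -[monomial k q]subr0; exact: cvgB (cvg_monomial_powser Qq) diff_cvg.
Qed.

End MonomialSeries.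

Lemma dominated_double_boxsum (R : realType) n
    (f g : {ffun 'I_n -> nat} -> nat -> Cplx R) :
  (forall k L, `|f k L| <= g k L) ->
  (forall k L K, (L <= K)%N -> `|f k K - f k L| <= g k K - g k L) ->
  dominated_double (fun N L => boxsum (f^~ L) N) (fun N L => boxsum (g^~ L) N).
Proof.
move=> fg fg_incr N M L K NM LK.
have telescope (V : zmodType) (u v w : V) : u - w = (u - v) + (v - w).
  by rewrite addrA subrK.
rewrite (telescope _ _ (boxsum (f^~ L) M))
  [leRHS](telescope _ _ (boxsum (g^~ L) M)).
apply: le_trans (ler_normD _ _) (lerD _ (norm_boxsumB_le _ NM)) => //.
by have := norm_boxsum_le M (fun k => fg_incr k _ _ LK); rewrite !boxsumB.
Qed.

Lemma boxsum_powser (R : realType) n (a : mcoefs R n)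
    (c : {ffun 'I_n -> nat} -> nat -> Cplx R) x N L :
  boxsum (fun k => a k * powser (c k) x L) N =
  powser (fun p => boxsum (fun k => a k * c k p) N) x L.
Proof.
rewrite /powser; under eq_boxsum do rewrite mulr_sumr.
rewrite boxsum_sum; apply: eq_bigr => p _.
by rewrite mulrC -boxsumZ; apply: eq_boxsum => k; rewrite mulrA mulrC.
Qed.

Section Composition.
Variables (R : realType) (n : nat) (a : mcoefs R n).
Local Notation C := (Cplx R).
Variable Q : 'I_n -> nat -> C.

Definition comp_coef (p : nat) : C :=
  limn (boxsum (fun k => a k * monomial_coef k Q p)).

Variables (x : C) (y : 'rV[C]_n) (g : 'I_n -> C).
Hypotheses (x_neq0 : x != 0) (a_bounded : abs_bounded a g).
Hypothesis Q_cvg : forall i, powser (Q i) x N @[N --> \oo] --> y 0 i.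
Hypothesis Q_le : forall i N, powser (fun l => `|Q i l|) `|x| N <= g i.

Let G i l : C := `|Q i l|.

Let G_ge0 i l : 0 <= G i l. Proof. exact: normr_ge0. Qed.

Let powser_G_le k N : powser (monomial_coef k G) `|x| N <= monomial k g.
Proof.
apply: le_trans (powser_monomial_coef_le k G_ge0 (normr_ge0 x) N) _.
by apply: le_monomial => i; [exact: powser_ge0|exact: Q_le].
Qed.

Lemma comp_coef_cvg p :
  boxsum (fun k => a k * monomial_coef k Q p) N @[N --> \oo] --> comp_coef p.
Proof.
have [B aB] := a_bounded.
have xp : 0 < `|x| ^+ p by rewrite exprn_gt0// normr_gt0.
apply: (@dominated_boxsum_is_cvg _ _ _
  (fun k => (`|x| ^+ p)^-1 * (`|a k| * monomial k g))
  ((`|x| ^+ p)^-1 * B)) => [k|N]; last by rewrite boxsumZ ler_pM2l ?invr_gt0.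
rewrite normrM mulrCA ler_wpM2l// mulrC ler_pdivlMr//.
apply: le_trans (powser_G_le k p.+1); rewrite /powser big_ord_recr/=.
apply: (@le_trans _ _ (monomial_coef k G p * `|x| ^+ p)).
  by rewrite ler_pM2r// norm_monomial_coef_le.
rewrite lerDr; apply: powser_ge0 => // l; exact: monomial_coef_ge0.
Qed.

Lemma comp_powser_cvg : powser comp_coef x L @[L --> \oo] --> msum a y.
Proof.
have [B aB] := a_bounded.
pose f k L := a k * powser (monomial_coef k Q) x L.
pose F k L := `|a k| * powser (monomial_coef k G) `|x| L.
have QG k p : `|monomial_coef k Q p| <= monomial_coef k G p.
  exact: norm_monomial_coef_le.
have y_le i : `|y 0 i| <= g i.
  apply: (limC_le (cvg_norm (@Q_cvg i))) => N.
  by apply: le_trans (Q_le i N); exact: norm_powser_le.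
apply: (dominated_double_exchange (B := B)
  (dominated_double_boxsum (f := f) (g := F) _ _)
  _ _ _ (msum_cvg a_bounded y_le)) => [k L|k L K LK|N L|N|L].
- by rewrite normrM ler_wpM2l// norm_powser_le.
- by rewrite -!mulrBr normrM ler_wpM2l// norm_powserB_le.
- apply: le_trans (aB N); apply: le_boxsum => k.
  by rewrite ler_wpM2l.
- apply: cvg_big => [|k _]; first exact: add_continuous.
  apply: cvgMl_tmp; exact: monomial_powser_cvg Q_le.
- under eq_cvg do rewrite boxsum_powser.
  apply: cvg_big => [|p _]; first exact: add_continuous.
  by apply: cvgMr_tmp; exact: comp_coef_cvg.
Qed.

End Composition.

(** * Coefficients of the solution *)

Section Points.
Variables (R : realType) (m : nat).
Local Notation C := (Cplx R).

Lemma zU_point_l (z : C) (v : 'rV[C]_m) i : zU_point z v 0 (lshift m i) = z.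
Proof. by rewrite row_mxEl (ord1 i) mxE eqxx mulr1n. Qed.

Lemma zU_point_r (z : C) (v : 'rV[C]_m) j : zU_point z v 0 (rshift 1 j) = v 0 j.
Proof. by rewrite row_mxEr. Qed.

Lemma zU_point_all2 (P : C -> C -> Prop) (z w : C) (u v : 'rV[C]_m) :
  P z w -> (forall j, P (u 0 j) (v 0 j)) ->
  forall i, P (zU_point z u 0 i) (zU_point w v 0 i).
Proof.
by move=> Pzw Puv i; case: (split_ordP i) => k ->;
  rewrite ?zU_point_l ?zU_point_r.
Qed.

Lemma zU_point_all (P : C -> Prop) (z : C) (v : 'rV[C]_m) :
  P z -> (forall j, P (v 0 j)) -> forall i, P (zU_point z v 0 i).
Proof. exact: (@zU_point_all2 (fun c _ => P c) z z v v). Qed.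

Lemma zU_point_ge0 (z : C) (v : 'rV[C]_m) :
  0 <= z -> (forall j, 0 <= v 0 j) -> forall i, 0 <= zU_point z v 0 i.
Proof. exact: (@zU_point_all (fun c => 0 <= c)). Qed.

Lemma zU_pointB (z w : C) (v u : 'rV[C]_m) :
  zU_point z v - zU_point w u = zU_point (z - w) (v - u).
Proof. by rewrite /zU_point opp_row_mx add_row_mx raddfB. Qed.

Lemma norm_zU_point (z : C) (v : 'rV[C]_m) e :
  `|z| <= e -> `|v| <= e -> `|zU_point z v| <= e.
Proof.
move=> ze ve; apply: ler_mx_norm => [|i j]; first exact: le_trans ve.
rewrite (ord1 i); apply: (@zU_point_all (fun c => `|c| <= e)) => // k.
exact: le_trans (ler_norm_entry _ _ _) ve.
Qed.

Lemma sum_zU_point (z : C) (v : 'rV[C]_m) (f : 'I_(1 + m) -> C) :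
  \sum_l zU_point z v 0 l * f l =
  z * f (lshift m ord0) + \sum_k v 0 k * f (rshift 1 k).
Proof.
rewrite big_split_ord/= big_ord1 zU_point_l; congr (_ + _).
by apply: eq_bigr => k _; rewrite zU_point_r.
Qed.

End Points.

Section NilpotentEquation.
Variables (K : numFieldType) (m : nat) (D : 'M[K]_m) (p : nat).
Hypothesis D_nilpotent : D ^+ p = 0.

Lemma nilpotent_geometric_sum (v : 'cV[K]_m) :
  v = \sum_(k < p) D ^+ k *m (v - D *m v).
Proof.
have partial_sum q : v = \sum_(k < q) D ^+ k *m (v - D *m v) + D ^+ q *m v.
  elim: q => [|q IH]; first by rewrite big_ord0 add0r expr0 mul1mx.
  rewrite big_ord_recr/= mulmxBr mulmxA -addrA -[D ^+ q *m D]/(D ^+ q * D)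
    -exprSr.
  by rewrite subrK.
by have := partial_sum p; rewrite D_nilpotent mul0mx addr0.
Qed.

Lemma nilpotent_supersolution_ge0 (v : 'cV[K]_m) : (forall i j, 0 <= D i j) ->
  (forall j, 0 <= (v - D *m v) j 0) -> forall j, 0 <= v j 0.
Proof.
move=> D0 g0 j; rewrite (nilpotent_geometric_sum v) summxE.
apply: sumr_ge0 => k _; rewrite mxE; apply: sumr_ge0 => l _; rewrite mulr_ge0//.
elim: (k : nat) j l => [|q IH] j l; first by rewrite expr0 mxE ler0n.
by rewrite exprSr mxE; apply: sumr_ge0 => i _; rewrite mulr_ge0.
Qed.

Lemma nilpotent_solution_eq0 (v : 'cV[K]_m) : v = D *m v -> v = 0.
Proof.
move=> vD; rewrite (nilpotent_geometric_sum v) -vD subrr.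
by rewrite big1// => k _; rewrite mulmx0.
Qed.

End NilpotentEquation.

Lemma gf_valE (R : realType) m (U : gf R m) z j :
  gf_val U z 0 j = powsum (U j) z.
Proof. by rewrite mxE series_powser. Qed.

Lemma gf_cvg_powser (R : realType) m (U : gf R m) z : gf_cvg U z <->
  (forall j, cvgn (powser (U j) z)).
Proof. by split=> Uz j; have := Uz j; rewrite series_powser. Qed.

(* Unification otherwise unfolds the limits defining the values at distinct
   points before failing. *)
Opaque gf_val.

Section Coefficients.
Variables (R : realType) (m : nat) (h : system R m) (U : gf R m).
Local Notation C := (Cplx R).
Hypotheses (wf : well_founded_system h) (sol : gf_solution h U).

Definition wf_point : 'rV[C]_(1 + m) := zU_point 0 (wf_iter h m).

Definition upoint (z : C) : 'rV[C]_(1 + m) := zU_point z (gf_val U z).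

Definition upoint_coef (i : 'I_(1 + m)) (l : nat) : C :=
  zU_point (l == 1%N)%:R (\row_j U j l) 0 i.

Lemma wf_coef_ge0 j k : 0 <= h j k.
Proof. by have [_ ->] := wf. Qed.

Lemma wf_iter_ge0 k j : (k <= m)%N -> 0 <= wf_iter h k 0 j.
Proof.
have [_ _ iter_dom _] := wf.
elim: k j => [|k IH] j km; first by rewrite mxE.
have x0 : forall i, 0 <= zU_point 0 (wf_iter h k) 0 i.
  by apply: zU_point_ge0 => // l; exact: IH (ltnW km).
have /(@conv_dom_interior _ _ _ _ j) x_in := iter_dom k (ltnW km).
rewrite /= sys_mapE; have [d d0 xd] := interior_abs_bounded x_in x0.
apply: limC_ge (msum_cvg xd _) _ => [i|N];
  first by rewrite ger0_norm// lerDl ltW.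
by apply: boxsum_ge0 => k'; rewrite mulr_ge0 ?monomial_ge0 ?wf_coef_ge0.
Qed.

Lemma wf_point_ge0 i : 0 <= wf_point 0 i.
Proof. by apply: zU_point_ge0 => // j; exact: wf_iter_ge0. Qed.

Lemma conv_dom_wf_point : conv_dom h wf_point.
Proof. by have [_ _ /(_ m (leqnn m))] := wf. Qed.

Let wf_interior j : interior (abs_cvg (h j)) wf_point :=
  conv_dom_interior j conv_dom_wf_point.

Lemma upoint_powser_cvg z i : gf_cvg U z ->
  powser (upoint_coef i) z N @[N --> \oo] --> upoint z 0 i.
Proof.
move=> /gf_cvg_powser Uz; rewrite /upoint; case: (split_ordP i) => k ->.
  have -> : upoint_coef (lshift m k) = fun l => (l == 1%N)%:R.
    by apply/funext => l; rewrite /upoint_coef zU_point_l.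
  rewrite zU_point_l; apply: cvg_near_cst; exists 2%N => // -[|[|N]]//= _.
  rewrite 2!powserS add0r /powser big1 => [|l _]; last by rewrite mul0r.
  by rewrite mulr0 addr0 mulr1.
have -> : upoint_coef (rshift 1 k) = U k.
  by apply/funext => l; rewrite /upoint_coef zU_point_r mxE.
by rewrite zU_point_r gf_valE; exact: Uz.
Qed.

Lemma upoint_coef0 i : upoint_coef i 0%N = wf_point 0 i.
Proof.
have [_ _ U0] := sol; rewrite /upoint_coef /wf_point -U0.
congr (zU_point _ _ _ _).
by apply/rowP => j; rewrite gf_valE powsum0 mxE.
Qed.

Lemma sol_near0 : exists2 e, 0 < e & forall x, `|x| <= e ->
  [/\ gf_cvg U x, conv_dom h (upoint x) &
      forall j, msum (h j) (upoint x) = powsum (U j) x].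
Proof.
have [U_cvg U_eq _] := sol.
have [e e0 eP] := nbhs0_pos (filterI U_cvg U_eq).
exists e => // x /eP[xU [x_dom x_eq]]; split=> // j.
by rewrite -sys_mapE -gf_valE x_eq.
Qed.

Lemma upoint_coef_le_near0 d : 0 < d -> exists e, [/\ 0 < e,
  forall x, 0 < x -> x <= e -> gf_cvg U x,
  forall x j, 0 < x -> x <= e -> msum (h j) (upoint x) = powsum (U j) x &
  forall i x N, 0 < x -> x <= e ->
    powser (fun l => `|upoint_coef i l|) x N <= wf_point 0 i + d].
Proof.
move=> d0; have [e e0 eP] := sol_near0.
have [|e1 [e10 e1e bound]] := powser_abs_le_near0 (c := upoint_coef) e0 d0.
  have [|U_cvg _ _] := eP e; first by rewrite gtr0_norm.
  by move=> i; apply: cvgP; exact: upoint_powser_cvg.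
have near x : 0 < x -> x <= e1 -> `|x| <= e.
  by move=> x0 xe1; rewrite gtr0_norm// (le_trans xe1).
exists e1; split=> // [x x0 xe1|x j x0 xe1|i x N x0 xe1].
- by have [] := eP x (near x x0 xe1).
- by have [_ _] := eP x (near x x0 xe1).
- apply: le_trans (bound i x N (ltW x0) xe1) _.
  by rewrite upoint_coef0 ger0_norm ?wf_point_ge0.
Qed.

(* The coefficient of [z ^ p] in the equation U_j = H_j(z, U). *)
Lemma sol_coef_cvg j p :
  boxsum (fun k => h j k * monomial_coef k upoint_coef p) N
    @[N --> \oo] --> U j p.
Proof.
have [d d0 xd] := interior_abs_bounded (wf_interior j) wf_point_ge0.
have [e [e0 U_cvg U_eq U_le]] := upoint_coef_le_near0 d0.
have coef_le x i N : 0 < x -> x <= e ->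
    powser (fun l => `|upoint_coef i l|) `|x| N <= wf_point 0 i + d.
  by move=> x0 xe; rewrite gtr0_norm// U_le.
suff <- : comp_coef (h j) upoint_coef p = U j p.
  have coef_le_e i N := coef_le e i N e0 (lexx e).
  exact: (@comp_coef_cvg _ _ _ _ _ _ (lt0r_neq0 e0) xd coef_le_e p).
apply: (powser_lim_inj (f := powsum (U j)) e0) => x x0 xe.
  rewrite -U_eq//.
  apply: comp_powser_cvg (lt0r_neq0 x0) xd _ (fun i N => coef_le x i N x0 xe).
  by move=> i; exact: upoint_powser_cvg (U_cvg x x0 xe).
by have /gf_cvg_powser := U_cvg x x0 xe.
Qed.

Lemma sum_upoint_coef p (f : 'I_(1 + m) -> C) : \sum_l upoint_coef l p * f l =
  (p == 1%N)%:R * f (lshift m ord0) + \sum_k U k p * f (rshift 1 k).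
Proof.
by rewrite sum_zU_point; congr (_ + _); apply: eq_bigr => k _; rewrite mxE.
Qed.

Lemma sol_coef_trunc_cvg j p : (0 < p)%N ->
  boxsum (fun k => h j k * (monomial k (poly_trunc upoint_coef p))`_p) N
    @[N --> \oo] --> U j p - \sum_l upoint_coef l p * mgrad (h j) l wf_point.
Proof.
move=> p0; have wfE : wf_point 0 = fun i => upoint_coef i 0%N.
  by apply/funext => i; rewrite upoint_coef0.
have -> : boxsum (fun k => h j k * (monomial k (poly_trunc upoint_coef p))`_p) =
    boxsum (fun k => h j k * monomial_coef k upoint_coef p) \-
    (fun N => \sum_l upoint_coef l p *
       boxsum (fun k => h j k * dmonomial k l (wf_point 0)) N).
  apply/funext => N /=; under [X in _ - X]eq_bigr do rewrite -boxsumZ.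
  rewrite -boxsum_sum -boxsumB; apply: eq_boxsum => k.
  rewrite monomial_coef_split// mulrDr -wfE mulr_sumr -addrA.
  under [X in _ + (X - _)]eq_bigr do rewrite mulrCA.
  by rewrite subrr addr0.
apply: cvgB (@sol_coef_cvg j p) _; apply: cvg_big => [|l _].
  exact: add_continuous.
apply: cvgMl_tmp; exact: interior_mgrad_cvg (wf_interior j) wf_point_ge0 _.
Qed.

Let D : 'M[C]_m := dHdU h wf_point.

Let u p : 'cV[C]_m := \col_j U j p.

Lemma wf_jacobian_ge0 i j : 0 <= D i j.
Proof.
rewrite /D (dHdUE _ _ conv_dom_wf_point wf_point_ge0).
exact: mgrad_ge0 (wf_interior i) wf_point_ge0 (wf_coef_ge0 i) _.
Qed.

Lemma sol_coef_residualE p j : (u p - D *m u p) j 0 =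
  U j p - \sum_l upoint_coef l p * mgrad (h j) l wf_point
  + (p == 1%N)%:R * mgrad (h j) (lshift m ord0) wf_point.
Proof.
have -> : (u p - D *m u p) j 0 =
    U j p - \sum_k U k p * mgrad (h j) (rshift 1 k) wf_point.
  rewrite 4!mxE; congr (_ - _); apply: eq_bigr => k _.
  by rewrite /D (dHdUE _ _ conv_dom_wf_point wf_point_ge0) mxE mulrC.
by rewrite sum_upoint_coef; ring.
Qed.

Lemma sol_coef_ge0 j p : 0 <= U j p.
Proof.
elim/ltn_ind: p j => p IH j; have [->|p0] := posnP p.
  have := upoint_coef0 (rshift 1 j).
  by rewrite /upoint_coef zU_point_r mxE => ->; exact: wf_point_ge0.
have [_ _ _ [q Dq]] := wf; have -> : U j p = u p j 0 by rewrite mxE.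
apply: (nilpotent_supersolution_ge0 Dq wf_jacobian_ge0) => l.
rewrite sol_coef_residualE addr_ge0//; last first.
  rewrite mulr_ge0//.
  exact: mgrad_ge0 (wf_interior l) wf_point_ge0 (wf_coef_ge0 l) _.
apply: limC_ge (@sol_coef_trunc_cvg l p p0) _ => N; apply: boxsum_ge0 => k.
rewrite mulr_ge0 ?wf_coef_ge0//.
have trunc_norm i c : `|(poly_trunc upoint_coef p i)`_c| <=
    (poly_trunc upoint_coef p i)`_c.
  rewrite coef_poly; case: ltnP => [cp|_]; last by rewrite normr0.
  rewrite ger0_norm//; apply: zU_point_ge0 => [|k']; first by case: eqP.
  by rewrite mxE IH.
exact: le_trans (normr_ge0 _) (norm_coef_monomial_le k p trunc_norm).
Qed.

Lemma sol_coef_z_independent :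
  (forall j (k : {ffun 'I_(1 + m) -> nat}), (0 < k (lshift m ord0))%N ->
    h j k = 0) ->
  forall j p, (0 < p)%N -> U j p = 0.
Proof.
move=> hz j p; elim/ltn_ind: p j => p IH j p0.
have trunc_const l : poly_trunc upoint_coef p (rshift 1 l) = (U l 0%N)%:P.
  apply/polyP => c; rewrite coef_poly coefC /upoint_coef zU_point_r mxE.
  by case: c => [|c]; [rewrite p0|case: ifP => // cp; rewrite IH].
have term0 l k : h l k * (monomial k (poly_trunc upoint_coef p))`_p = 0.
  have [kz|/hz ->] := posnP (k (lshift m ord0)); last by rewrite mul0r.
  have -> : monomial k (poly_trunc upoint_coef p) =
      (\prod_j U j 0%N ^+ k (rshift 1 j))%:P.
    rewrite /monomial big_split_ord/= big_ord1 kz expr0 mul1r rmorph_prod/=.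
    by apply: eq_bigr => i _; rewrite trunc_const rmorphXn.
  by rewrite coefC gtn_eqF// mulr0.
have mgrad0 l : mgrad (h l) (lshift m ord0) wf_point = 0.
  apply: (@lim_near_cst C) => //; apply: nearW => N.
  rewrite /boxsum big1// => k _.
  set k' := [ffun _ => _]; have [kz|/hz ->] := posnP (k' (lshift m ord0)).
    by rewrite /dmonomial kz !mul0r mulr0.
  by rewrite mul0r.
have [_ _ _ [q Dq]] := wf; suff uD : u p = D *m u p.
  by have := nilpotent_solution_eq0 Dq uD; move/colP/(_ j); rewrite !mxE.
apply/eqP; rewrite -subr_eq0; apply/eqP/colP => l; rewrite sol_coef_residualE.
rewrite mgrad0 mulr0 addr0 [RHS]mxE.
apply: (cvg_unique _ (@sol_coef_trunc_cvg l p p0)) => //.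
by apply: cvg_near_cst; apply: nearW => N; rewrite /boxsum big1// => k _.
Qed.

End Coefficients.

(** * The solution up to its radius of convergence *)

Section Extension.
Variables (R : realType) (m : nat) (h : system R m) (U : gf R m).
Local Notation C := (Cplx R).
Hypotheses (wf : well_founded_system h) (sol : gf_solution h U).

Let h_ge0 := wf_coef_ge0 wf.
Let U_ge0 := sol_coef_ge0 wf sol.

Lemma upoint_coef_ge0 i l : 0 <= upoint_coef U i l.
Proof. by apply: zU_point_ge0 => [|j]; [case: eqP|rewrite mxE U_ge0]. Qed.

Lemma gf_val_ge0 x j : 0 <= x -> gf_cvg U x -> 0 <= gf_val U x 0 j.
Proof.
by move=> x0 /gf_cvg_powser xU; rewrite gf_valE powsum_ge0.
Qed.

Lemma gf_cvg_le x y : gf_cvg U y -> 0 <= x -> x <= y -> gf_cvg U x.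
Proof.
move=> /gf_cvg_powser yU x0 xy; apply/gf_cvg_powser => j.
exact: cvg_powser_le (yU j) x0 xy.
Qed.

Lemma exists_nonconstant_coef_gt0 x i : gf_val U x 0 i != gf_val U 0 0 i ->
  exists2 n, (0 < n)%N & 0 < U i n.
Proof.
move=> Ux_neq; apply: contrapT => U_const; move/eqP: Ux_neq; apply.
rewrite [LHS]gf_valE [RHS]gf_valE powsum0 powsum_const// => n n0.
apply/eqP; apply: contrapT.
by move=> /negP Un; apply: U_const; exists n; rewrite ?lt_def ?Un ?U_ge0.
Qed.

Lemma upoint_ge0 x i : 0 <= x -> gf_cvg U x -> 0 <= upoint U x 0 i.
Proof. by move=> x0 xU; apply: zU_point_ge0 => // j; exact: gf_val_ge0. Qed.

Lemma boxsum_upoint_le x j N : 0 <= x -> gf_cvg U x ->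
  boxsum (fun k => h j k * monomial k (upoint U x 0)) N <= powsum (U j) x.
Proof.
move=> x0 xU; have /gf_cvg_powser U_cvg := xU.
have partial_cvg : boxsum (fun k => h j k *
    powser (monomial_coef k (upoint_coef U)) x L) N @[L --> \oo] -->
    boxsum (fun k => h j k * monomial k (upoint U x 0)) N.
  apply: cvg_big => [|k _]; first exact: add_continuous.
  apply: cvgMl_tmp; apply: nonneg_monomial_powser_cvg => // [|i].
    exact: upoint_coef_ge0.
  exact: upoint_powser_cvg.
apply: (limC_le partial_cvg) => L; rewrite boxsum_powser.
apply: le_trans (powser_le_powsum (U_ge0 j) L x0 (U_cvg j)).
apply: ler_sum => p _; rewrite ler_wpM2r ?exprn_ge0//.
apply: (boxsum_le_lim _ (@sol_coef_cvg _ _ _ _ wf sol j p)) => k.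
rewrite mulr_ge0//; apply: monomial_coef_ge0; exact: upoint_coef_ge0.
Qed.

(* The equation, assumed near [0] only, propagates to the whole interval of
   convergence because all the coefficients are nonnegative. *)
Lemma sol_extends x j : 0 < x -> gf_cvg U x ->
  abs_cvg (h j) (upoint U x) /\ msum (h j) (upoint U x) = gf_val U x 0 j.
Proof.
move=> x0 xU; have x0' := ltW x0.
have upoint_norm i : `|upoint U x 0 i| = upoint U x 0 i.
  by rewrite ger0_norm// upoint_ge0.
have bounded : abs_bounded (h j) (upoint U x 0).
  exists (powsum (U j) x) => N.
  under eq_boxsum do rewrite ger0_norm//.
  exact: boxsum_upoint_le.
split.
  by apply/abs_cvgP; under eq_fun do rewrite upoint_norm.
have coefE : comp_coef (h j) (upoint_coef U) = U j.
  by apply/funext => p; apply: cvg_lim => //; exact: sol_coef_cvg.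
have msum_cvg : powser (U j) x N @[N --> \oo] --> msum (h j) (upoint U x).
  rewrite -[in X in X @ _]coefE.
  apply: (comp_powser_cvg (lt0r_neq0 x0) bounded) => i.
    exact: upoint_powser_cvg.
  move=> N; rewrite ger0_norm//.
  have -> : (fun l => `|upoint_coef U i l|) = upoint_coef U i.
    by apply/funext => l; rewrite ger0_norm// upoint_coef_ge0.
  apply: (nondecreasing_cvgC_le _ (upoint_powser_cvg xU)) => M L.
  by apply: powser_homo => // l; exact: upoint_coef_ge0.
have /gf_cvg_powser U_cvg := xU.
by rewrite gf_valE; exact: (cvg_unique _ msum_cvg (U_cvg j)).
Qed.

End Extension.

Lemma lipschitz_segment_continuous (R : realType) (f : R -> R) (K a b : R) :
  (forall x y, a <= x -> x <= y -> y <= b -> `|f y - f x| <= K * (y - x)) ->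
  {within `[a, b], continuous f}.
Proof.
move=> f_lip; apply/subspace_continuousP => x /=.
rewrite in_itv/= => /andP[ax xb].
have lip y : a <= y -> y <= b -> `|f x - f y| <= `|K| * `|x - y|.
  move=> ay yb; rewrite -normrM; have [xy|/ltW yx] := leP x y.
    rewrite distrC (le_trans (f_lip _ _ ax xy yb))// (le_trans (ler_norm _))//.
    by rewrite -normrN -mulrN opprB.
  by rewrite (le_trans (f_lip _ _ ay yx xb))// ler_norm.
apply/cvgrPdist_lt => e e0; have K0 : 0 < `|K| + 1 by rewrite ltr_wpDl.
rewrite near_withinE; near=> y; rewrite /= in_itv/= => /andP[ay yb].
apply: le_lt_trans (lip y ay yb) _.
apply: le_lt_trans (_ : _ <= (`|K| + 1) * `|x - y|) _.
  by rewrite ler_wpM2r// lerDl.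
rewrite mulrC -ltr_pdivlMr//; near: y.
by apply: cvgr_dist_lt; rewrite ?divr_gt0//; exact: cvg_id.
Unshelve. all: by end_near. Qed.

Section Radius.
Variables (R : realType) (m : nat) (h : system R m) (U : gf R m).
Local Notation C := (Cplx R).

Lemma gf_cvg_beyond (t : R) : 0 <= t -> (t%:E < conv_radius U)%E ->
  exists2 s, t < s & gf_cvg U (toC s).
Proof.
move=> t0 /ereal_sup_gt[_ [z /gf_cvg_powser zU <-]]; rewrite lte_fin => tz.
exists ((t + reC `|z|) / 2); first lra.
set s : C := toC _; have s0 : 0 <= s by rewrite toC_ge0; lra.
have sz : `|s| < `|z|.
  by rewrite ger0_norm// -(ge0_reCK (normr_ge0 z)) lt_toC; lra.
apply/gf_cvg_powser => j; have [B UB] := powser_abs_bounded (zU j) sz.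
by apply: dominated_is_cvgC UB => N M; exact: norm_powserB_le.
Qed.

Lemma ex_real_near_left (rho : \bar R) (P : \bar R -> Prop) : (0 < rho)%E ->
  (\forall y \near nbhs rho, (y < rho)%E -> P y) ->
  exists r : R, [/\ 0 < r, (r%:E < rho)%E & P r%:E].
Proof.
case: rho => [rho| |]//.
  rewrite lte_fin => rho0 nearP.
  have {}nearP : \forall r \near rho, (r%:E < rho%:E)%E -> P r%:E by [].
  have leftP : \forall r \near rho^'-, P r%:E.
    by rewrite near_withinE; apply: filterS nearP => r rP; rewrite -lte_fin.
  have [r [[r0 r_lt] rP]] :=
    filter_ex (filterI (filterI (nbhs_left_gt rho0) (nbhs_left_lt rho)) leftP).
  by exists r; split; rewrite ?lte_fin.
move=> _ [M [_ MP]]; exists (`|M| + 1); split;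
  [by rewrite ltr_wpDl|exact: ltry|].
apply: MP (ltry _); rewrite lte_fin.
by rewrite (le_lt_trans (ler_norm M))// ltrDl.
Qed.

Hypothesis sol : gf_solution h U.

Lemma conv_radius_gt0 : (0 < conv_radius U)%E.
Proof.
have [e e0 eP] := sol_near0 sol.
apply: lt_le_trans (ereal_sup_ubound _); last first.
  by exists e; [have [] := eP e; rewrite ?gtr0_norm|reflexivity].
by rewrite lte_fin gtr0_norm//; exact: lt_reC e0.
Qed.

Lemma value_at_radius_gt i c : 0 <= c -> (c%:E < value_at_radius U i)%E ->
  exists r : R, [/\ 0 < r, (r%:E < conv_radius U)%E &
    c < reC (gf_val U (toC r) 0 i)].
Proof.
move=> c0; rewrite /value_at_radius; set F := (X in lim X) => cF.
have F_cvg : cvg F.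
  apply: contrapT => /dvgP F0; move: cF.
  by rewrite F0 lte_fin ltNge c0.
have : nbhs (lim F) [set y : \bar R | (c%:E < y)%E].
  by apply: open_nbhs_nbhs; split=> //; exact: open_ereal_gt_ereal.
move=> /F_cvg; rewrite /F /= /within /=.
move=> /(ex_real_near_left conv_radius_gt0)[r [r0 r_lt cr]].
by exists r; split=> //; rewrite -lte_fin.
Qed.

Hypothesis wf : well_founded_system h.
Let U_ge0 := sol_coef_ge0 wf sol.

Lemma gf_val_continuous r s i : gf_cvg U (toC s) -> r < s ->
  {within `[0, r], continuous (fun x => reC (gf_val U (toC x) 0 i))}.
Proof.
move=> /gf_cvg_powser sU rs.
have -> : (fun x => reC (gf_val U (toC x) 0 i)) =
    fun x => reC (powsum (U i) (toC x)).
  by apply/funext => x; rewrite gf_valE.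
apply: (@lipschitz_segment_continuous _ _
  (reC (powsum (U i) (toC s)) / (s - r))).
move=> x y x0 xy yr; have ys := le_trans yr (ltW rs).
have x0' : 0 <= toC x by rewrite toC_ge0.
have xy' : toC x <= toC y by rewrite le_toC.
have ys' : toC y <= toC s by rewrite le_toC.
have yU : cvgn (powser (U i) (toC y)).
  exact: (cvg_powser_le (U_ge0 i) (sU i) (le_trans x0' xy') ys').
have U_incr : 0 <= powsum (U i) (toC y) - powsum (U i) (toC x).
  by rewrite subr_ge0; exact: (le_powsum (U_ge0 i) yU x0' xy').
have U_lip : powsum (U i) (toC y) - powsum (U i) (toC x) <=
    toC ((y - x) / (s - r)) * powsum (U i) (toC s).
  have yr' : toC y <= toC r by rewrite le_toC.
  have rs' : toC r < toC s by rewrite lt_toC.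
  apply: le_trans (powsum_lipschitz (U_ge0 i) (sU i) x0' xy' yr' rs') _.
  by rewrite -!rmorphB [in leRHS]rmorphM/= fmorphV mulrC mulrA mulrAC.
have := le_reC U_lip; have := le_reC U_incr.
rewrite reC_toCM raddfB/= => /ger0_norm -> /le_trans; apply.
by rewrite mulrC mulrA mulrAC.
Qed.

Lemma gf_val_eq_before_radius i c : 0 <= c -> reC (gf_val U 0 0 i) < c ->
  (c%:E < value_at_radius U i)%E ->
  exists t : R, [/\ 0 < t, (t%:E < conv_radius U)%E &
    gf_val U (toC t) 0 i = toC c].
Proof.
move=> c0 Uc /(value_at_radius_gt c0)[r [r0 r_lt cr]].
have [s rs sU] := gf_cvg_beyond (ltW r0) r_lt.
pose f x := reC (gf_val U (toC x) 0 i).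
have f0 : f 0 < c by rewrite /f rmorph0.
have [||t] := @IVT _ f 0 r c (ltW r0); first exact: gf_val_continuous sU rs.
  move: (f 0) (f r) f0 (cr : c < f r) => a b ac cb.
  by rewrite ge_min le_max (ltW ac) (ltW cb) orbT.
rewrite in_itv/= => /andP[t0 tr] ft; exists t; split.
- by rewrite lt_def t0 andbT; apply/eqP => t00; rewrite -ft t00 ltxx in f0.
- by apply: le_lt_trans r_lt; rewrite lee_fin.
- have t0' : 0 <= toC t by rewrite toC_ge0.
  have ts : toC t <= toC s by rewrite le_toC; exact: le_trans tr (ltW rs).
  have Ut0 : 0 <= gf_val U (toC t) 0 i.
    exact: (gf_val_ge0 wf sol i t0' (gf_cvg_le wf sol sU t0' ts)).
  by rewrite -ft /f ge0_reCK.
Qed.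

End Radius.

(** * Irreducible systems *)

Lemma connect_closed (T : finType) (e : rel T) (P : T -> Prop) :
  (forall j k, e j k -> P j -> P k) -> forall j k, connect e j k -> P j -> P k.
Proof.
move=> eP j k /connectP[p]; elim: p j => [|l p IH] j /=; first by move=> _ ->.
by move=> /andP[ejl lp] kE Pj; apply: (IH l) => //; exact: eP ejl Pj.
Qed.

Lemma fin_positive_lower_bound (K : numFieldType) (I : finType) (f : I -> K) :
  (forall i, 0 < f i) -> exists2 d : K, 0 < d & forall i, d <= f i.
Proof.
move=> f0; have sum_ge0 : 0 <= \sum_i (f i)^-1.
  by apply: sumr_ge0 => i _; rewrite invr_ge0 ltW.
have sum1_gt0 : 0 < \sum_i (f i)^-1 + 1 by rewrite ltr_wpDl.
exists (\sum_i (f i)^-1 + 1)^-1 => [|i]; first by rewrite invr_gt0.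
rewrite -[leRHS]invrK lef_pV2 ?posrE ?invr_gt0//.
rewrite (bigD1 i)//= -addrA lerDl addr_ge0// sumr_ge0// => k _.
by rewrite invr_ge0 ltW.
Qed.

Section IrreducibleSupersolutions.
Variables (K : realFieldType) (m : nat) (M : 'I_m -> 'I_m -> K) (e : rel 'I_m).
Variable w : 'I_m -> K.
Hypotheses (M_ge0 : forall j k, 0 <= M j k)
  (M_gt0 : forall j k, e j k -> 0 < M j k).
Hypotheses (e_connected : forall j k, connect e j k)
  (w_gt0 : forall j, 0 < w j).
Hypothesis w_super : forall j, \sum_k M j k * w k <= w j.

Lemma supersolution_contact (v : 'I_m -> K) (c : K) j :
  \sum_k M j k * v k <= v j -> c <= 0 -> (forall k, c * w k <= v k) ->
  v j = c * w j ->
  c * \sum_k M j k * w k = c * w j /\ forall k, e j k -> v k = c * w k.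
Proof.
move=> v_super c0 cwv vj; pose gap k := M j k * (v k - c * w k).
have gap_ge0 k : 0 <= gap k by rewrite mulr_ge0// subr_ge0.
have gapE : \sum_k gap k = \sum_k M j k * v k - c * \sum_k M j k * w k.
  by rewrite mulr_sumr -sumrB; apply: eq_bigr => k _; rewrite /gap; ring.
have sum_ge0 : 0 <= \sum_k gap k by apply: sumr_ge0.
have cw : c * w j <= c * \sum_k M j k * w k by rewrite ler_wnM2l.
rewrite vj in v_super.
have gap0 : \sum_k gap k = 0.
  by apply/eqP; rewrite eq_le sum_ge0 gapE andbT; lra.
split=> [|k jk]; first by rewrite gapE in gap0; lra.
move/eqP: gap0; rewrite psumr_eq0// => /allP/(_ k (mem_index_enum _)).
by rewrite mulf_eq0 gt_eqF ?M_gt0//= subr_eq0 => /eqP.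
Qed.

(* The contact set of [v] with the largest multiple [c w] below it is closed
   along the edges, so that it is everything as soon as [c <= 0]. *)
Lemma supersolution_sign (v : 'I_m -> K) :
  (exists j, \sum_k M j k * w k < w j) ->
  (forall j, \sum_k M j k * v k <= v j) ->
  (forall j, v j = 0) \/ (forall j, 0 < v j).
Proof.
move=> [j1 w_strict] v_super.
pose j0 := [arg min_(j < j1) (v j / w j)]%O; pose c := v j0 / w j0.
have cwv k : c * w k <= v k.
  by rewrite -ler_pdivlMr// /c /j0; case: arg_minP => // k0 _; exact.
have [c_gt0|c_le0] := ltP 0 c.
  by right=> j; apply: lt_le_trans (cwv j); rewrite mulr_gt0.
have contact j : v j = c * w j.
  have cj0 : v j0 = c * w j0 by rewrite /c divfK ?gt_eqF.
  apply: (connect_closed (P := fun j => v j = c * w j)) (e_connected j0 j) cj0.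
  move=> k l kl vk.
  by have [_ ->] := supersolution_contact (v_super k) c_le0 cwv vk.
have [c0|cN0] := eqVneq c 0; first by left=> j; rewrite contact c0 mul0r.
have [/(mulfI cN0) w_eq _] :=
  supersolution_contact (v_super _) c_le0 cwv (contact j1).
by rewrite w_eq ltxx in w_strict.
Qed.

End IrreducibleSupersolutions.

Section BorderedIrreducibleMatrix.
Variables (K : realFieldType) (m : nat) (M : 'I_m -> 'I_m -> K) (e : rel 'I_m).
Variables (w b : 'I_m -> K) (s : K) (j1 : 'I_m).
Hypotheses (M_ge0 : forall j k, 0 <= M j k)
  (M_gt0 : forall j k, e j k -> 0 < M j k).
Hypotheses (e_connected : forall j k, connect e j k)
  (w_gt0 : forall j, 0 < w j).
Hypotheses (b_ge0 : forall j, 0 <= b j) (b_gt0 : 0 < b j1) (s_gt0 : 0 < s).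
Hypothesis w_super : forall j, b j * s + \sum_k M j k * w k <= w j.

(* The sign of [v] is that of [a], so that [v i = 0] forces both to vanish. *)
Lemma bordered_kernel0 (i : 'I_m) (a : K) (v : 'I_m -> K) : v i = 0 ->
  (forall j, v j = b j * a + \sum_k M j k * v k) ->
  a = 0 /\ forall j, v j = 0.
Proof.
wlog a0 : a v / 0 <= a.
  move=> nonneg_case vi vE.
  have [a0|/ltW a0] := leP 0 a; first exact: nonneg_case.
  have [||j|/eqP] := nonneg_case (- a) (fun j => - v j).
  - by rewrite oppr_ge0.
  - by rewrite vi oppr0.
  - under eq_bigr do rewrite mulrN.
    by rewrite sumrN mulrN -opprD -vE.
  rewrite oppr_eq0 => /eqP -> v0; split=> // j.
  by apply/eqP; rewrite -oppr_eq0 v0.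
move=> vi vE; have bs_ge0 j : 0 <= b j * s by rewrite mulr_ge0// ltW.
have [j||j|v0|v_gt0] :=
  supersolution_sign M_ge0 M_gt0 e_connected w_gt0 _ _ (v := v).
- by apply: le_trans (w_super j); rewrite lerDr.
- by exists j1; apply: lt_le_trans (w_super j1); rewrite ltrDr mulr_gt0.
- by rewrite [leRHS]vE lerDr mulr_ge0.
- split=> //; have := vE j1.
  rewrite v0 big1 ?addr0 => [|l _]; last by rewrite v0 mulr0.
  by move/esym/eqP; rewrite mulf_eq0 gt_eqF//= => /eqP.
- by have := v_gt0 i; rewrite vi ltxx.
Qed.

End BorderedIrreducibleMatrix.

Section IrreducibleSystem.
Variables (R : realType) (m : nat) (h : system R m) (U : gf R m).
Local Notation C := (Cplx R).
Hypotheses (irr : irreducible_system h) (sol : gf_solution h U).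

Lemma irreducible_wf : well_founded_system h.
Proof. by case: irr. Qed.

Let wf := irreducible_wf.
Let h_ge0 := wf_coef_ge0 wf.
Let U_ge0 := sol_coef_ge0 wf sol.

Lemma exists_coef_gt0 j : exists n, 0 < U j n.
Proof.
have [_ zf _ _] := irr; apply: contrapT => U_le0; apply: (zf U sol j).
have Uj0 n : U j n = 0.
  apply/eqP; apply: contrapT => /negP Ujn; apply: U_le0; exists n.
  by rewrite lt_def Ujn U_ge0.
near=> z; rewrite gf_valE; apply: (@lim_near_cst C) => //.
by apply: nearW => N; rewrite /powser big1// => n _; rewrite Uj0 mul0r.
Unshelve. all: by end_near. Qed.

Lemma upoint_gt0 x i : 0 < x -> gf_cvg U x -> 0 < upoint U x 0 i.
Proof.
move=> x0 /gf_cvg_powser xU.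
apply: (@zU_point_all _ _ (fun c => 0 < c)) => // j.
have [n Un] := exists_coef_gt0 j; rewrite gf_valE.
exact: (powsum_gt0 _ x0 (xU j) Un).
Qed.

Section NonconstantCoordinate.
Variables (i : 'I_m) (n : nat).
Hypotheses (n_gt0 : (0 < n)%N) (Uin_gt0 : 0 < U i n).

Lemma exists_z_dependence : exists j (k : {ffun 'I_(1 + m) -> nat}),
  (0 < k (lshift m ord0))%N /\ h j k != 0.
Proof.
apply: contrapT => no_z; move: Uin_gt0.
rewrite (sol_coef_z_independent wf sol) ?ltxx// => j k k0.
by apply/eqP; apply: contrapT => /negP hjk; apply: no_z; exists j, k.
Qed.

Lemma gf_val_lt x y j : 0 < x -> x < y -> gf_cvg U y ->
  gf_val U x 0 j < gf_val U y 0 j.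
Proof.
move=> x0 xy yU; have xU := gf_cvg_le wf sol yU (ltW x0) (ltW xy).
have y0 := lt_trans x0 xy; have /gf_cvg_powser U_cvg := yU.
have up_le : forall l, upoint U x 0 l <= upoint U y 0 l.
  apply: (@zU_point_all2 _ _ (fun a b => a <= b)) => [|k]; first exact: ltW.
  rewrite [leLHS]gf_valE [leRHS]gf_valE.
  exact: (le_powsum (U_ge0 k) (U_cvg k) (ltW x0) (ltW xy)).
apply: contraT => Uj_ge; have [_ _ _ /(_ j i) ji] := irr.
have := connect_closed (P := fun j => ~ gf_val U x 0 j < gf_val U y 0 j) _ ji.
case=> [k l /asboolP[k' [k'l hk']] Uk Ul||].
- have [_ x_eq] := sol_extends wf sol k x0 xU.
  have [yd y_eq] := sol_extends wf sol k y0 yU.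
  apply: Uk; rewrite -[ltLHS]x_eq -[ltRHS]y_eq.
  apply: (msum_lt (h_ge0 k) (fun l => upoint_gt0 l x0 xU) up_le yd k'l hk').
  by rewrite [ltLHS]zU_point_r [ltRHS]zU_point_r.
- exact/negP.
- rewrite [ltLHS]gf_valE [ltRHS]gf_valE.
  exact: (lt_powsum (U_ge0 i) (U_cvg i) (ltW x0) xy n_gt0 Uin_gt0).
Qed.

Lemma upoint_lt x y l : 0 < x -> x < y -> gf_cvg U y ->
  upoint U x 0 l < upoint U y 0 l.
Proof.
move=> x0 xy yU; move: l.
apply: (@zU_point_all2 _ _ (fun a b => a < b)) => // j.
exact: gf_val_lt.
Qed.

Lemma upoint_conv_dom x y : 0 < x -> x < y -> gf_cvg U y ->
  conv_dom h (upoint U x).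
Proof.
move=> x0 xy yU; have xU := gf_cvg_le wf sol yU (ltW x0) (ltW xy).
have [|d d0 d_le] := @fin_positive_lower_bound C _
    (fun l => upoint U y 0 l - upoint U x 0 l).
  by move=> l; rewrite subr_gt0 upoint_lt.
apply/nbhs_ballP; exists d; first exact: d0.
move=> z; rewrite -ball_normE/= => zd j.
have [/abs_cvgP yd _] := sol_extends wf sol j (lt_trans x0 xy) yU.
apply/abs_cvgP; apply: abs_bounded_le yd => [l|l]; first exact: normr_ge0.
rewrite [leRHS]ger0_norm; last exact/ltW/upoint_gt0/yU/(lt_trans x0 xy).
have -> : z 0 l = upoint U x 0 l - (upoint U x - z) 0 l.
  by rewrite [X in _ - X]mxE [X in _ - (_ + X)]mxE opprB addrCA subrr addr0.
apply: le_trans (ler_normB _ _) _; rewrite ger0_norm; last exact/ltW/upoint_gt0.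
rewrite addrC -lerBrDr; apply: le_trans (d_le l).
exact: le_trans (ler_norm_entry _ _ _) (ltW zd).
Qed.

End NonconstantCoordinate.
End IrreducibleSystem.

(** * The augmented system *)

Section AugmentedSystem.
Variables (R : realType) (m : nat) (h : system R m) (i : 'I_m).
Local Notation C := (Cplx R).
Implicit Types (x e : 'rV[C]_(1 + m)).

Definition aug_grad x : 'M[C]_(1 + m) :=
  row_mx (col (rshift 1 i) 1%:M) (col_mx 0 1%:M - sysgrad h x).

Lemma mul_aug_grad e x :
  e *m aug_grad x = zU_point (rsubmx e 0 i) (rsubmx e - e *m sysgrad h x).
Proof.
rewrite /aug_grad /zU_point mul_mx_row mulmxBr; congr row_mx.
  rewrite colE mul1mx -colE; apply/matrixP => a b.
  by rewrite !ord1 !mxE eqxx mulr1n.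
congr (_ - _); rewrite -[in LHS](hsubmxK e) mul_row_col mulmx0 add0r.
by rewrite mulmx1.
Qed.

Lemma aug_quad_approx x d B : 0 <= B ->
  quad_approx (sys_map h) (sysgrad h) x d B ->
  quad_approx (augmented_map h i) aug_grad x d B.
Proof.
move=> B0 h_approx u v ud vd; rewrite mul_aug_grad /augmented_map !zU_pointB.
apply: norm_zU_point.
  have -> : rsubmx v 0 i - 1 - (rsubmx u 0 i - 1) - rsubmx (v - u) 0 i = 0.
    by rewrite !mxE; ring.
  by rewrite normr0 mulr_ge0 ?exprn_ge0.
have -> : rsubmx v - sys_map h v - (rsubmx u - sys_map h u)
    - (rsubmx (v - u) - (v - u) *m sysgrad h u) =
    - (sys_map h v - sys_map h u - (v - u) *m sysgrad h u).
  have -> : rsubmx (v - u) = rsubmx v - rsubmx u by exact: raddfB.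
  move: (rsubmx v) (rsubmx u) (sys_map h v) (sys_map h u) (_ *m _).
  move=> vU uU Hv Hu e.
  by apply/rowP => j; rewrite !mxE; ring.
by rewrite normrN; exact: h_approx.
Qed.

Lemma aug_grad_kernel e x : e *m aug_grad x = 0 ->
  rsubmx e 0 i = 0 /\ forall j, rsubmx e 0 j =
    mgrad (h j) (lshift m ord0) x * e 0 (lshift m ord0) +
    \sum_k mgrad (h j) (rshift 1 k) x * rsubmx e 0 k.
Proof.
rewrite mul_aug_grad => e0.
have coord0 l :
    zU_point (rsubmx e 0 i) (rsubmx e - e *m sysgrad h x) 0 l = 0.
  by rewrite e0 mxE.
split=> [|j]; first by have := coord0 (lshift m ord0); rewrite zU_point_l.
have := coord0 (rshift 1 j); rewrite zU_point_r mxE [X in _ + X]mxE.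
move/eqP; rewrite subr_eq0 => /eqP ->; rewrite mxE big_split_ord/= big_ord1.
congr (_ + _); first by rewrite mxE mulrC.
by apply: eq_bigr => k _; rewrite [in LHS]mxE [in RHS]mxE mulrC.
Qed.

End AugmentedSystem.

Section NewtonAtSolution.
Variables (R : realType) (m : nat) (h : system R m) (U : gf R m).
Local Notation C := (Cplx R).
Hypotheses (irr : irreducible_system h) (sol : gf_solution h U).
Variables (i : 'I_m) (n : nat).
Hypotheses (n_gt0 : (0 < n)%N) (Uin_gt0 : 0 < U i n).
Variables (x y s : C).
Hypotheses (x_gt0 : 0 < x) (xy : x < y) (ys : y < s) (sU : gf_cvg U s).

Let wf := irreducible_wf irr.
Let h_ge0 := wf_coef_ge0 wf.
Let y_gt0 := lt_trans x_gt0 xy.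
Let yU : gf_cvg U y := gf_cvg_le wf sol sU (ltW y_gt0) (ltW ys).
Let xU : gf_cvg U x := gf_cvg_le wf sol yU (ltW x_gt0) (ltW xy).
Let zeta := upoint U x.

Let zeta_gt0 l : 0 < zeta 0 l.
Proof. exact: (upoint_gt0 irr sol l x_gt0 xU). Qed.

Let zeta_ge0 l : 0 <= zeta 0 l. Proof. exact: ltW (zeta_gt0 l). Qed.

Lemma zeta_conv_dom : conv_dom h zeta.
Proof. exact: (upoint_conv_dom irr sol n_gt0 Uin_gt0 x_gt0 xy yU). Qed.

Let zeta_interior j := conv_dom_interior j zeta_conv_dom.

Definition real_jac (j : 'I_m) (l : 'I_(1 + m)) : R := reC (mgrad (h j) l zeta).

Let mgrad_zeta_ge0 j l : 0 <= mgrad (h j) l zeta.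
Proof. exact: (mgrad_ge0 (zeta_interior j) zeta_ge0 (h_ge0 j)). Qed.

Lemma real_jac_ge0 j l : 0 <= real_jac j l.
Proof. exact: le_reC (mgrad_zeta_ge0 j l). Qed.

Lemma real_jac_gt0 j l (k : {ffun 'I_(1 + m) -> nat}) :
  (0 < k l)%N -> h j k != 0 -> 0 < real_jac j l.
Proof.
move=> kl hk.
exact: lt_reC (mgrad_gt0 (zeta_interior j) zeta_ge0 (h_ge0 j) zeta_gt0 kl hk).
Qed.

Lemma additive_jac_apply (p : {additive C -> R}) j (a : C) (v : 'I_m -> C) :
  (forall c z, 0 <= c -> p (c * z) = reC c * p z) ->
  p (mgrad (h j) (lshift m ord0) zeta * a +
     \sum_k mgrad (h j) (rshift 1 k) zeta * v k) =
  real_jac j (lshift m ord0) * p a + \sum_k real_jac j (rshift 1 k) * p (v k).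
Proof.
move=> pM; rewrite raddfD raddf_sum pM//; congr (_ + _).
by apply: eq_bigr => k _; rewrite pM.
Qed.

(* Convexity of H on the segment from U(x) to U(y). *)
Lemma gf_val_increment_ge j :
  mgrad (h j) (lshift m ord0) zeta * (y - x) +
  \sum_k mgrad (h j) (rshift 1 k) zeta * (gf_val U y 0 k - gf_val U x 0 k)
  <= gf_val U y 0 j - gf_val U x 0 j.
Proof.
have y_dom := upoint_conv_dom irr sol n_gt0 Uin_gt0 y_gt0 ys sU.
have y_ge0 l : 0 <= upoint U y 0 l.
  exact: ltW (upoint_gt0 irr sol l y_gt0 yU).
have zeta_le l : zeta 0 l <= upoint U y 0 l.
  exact: ltW (upoint_lt irr sol n_gt0 Uin_gt0 l x_gt0 xy yU).
have y_interior := conv_dom_interior j y_dom.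
have := msum_convex y_interior y_ge0 (h_ge0 j) zeta_ge0 zeta_le.
have [_ eq_y] := sol_extends wf sol j y_gt0 yU.
have [_ eq_x] := sol_extends wf sol j x_gt0 xU.
rewrite [X in _ <= X - _]eq_y [X in _ <= _ - X]eq_x zU_pointB sum_zU_point.
apply: le_trans; apply: lerD; first by rewrite mulrC.
apply: ler_sum => k _.
by rewrite mulrC [X in _ <= X * _]mxE [X in _ <= (_ + X) * _]mxE.
Qed.

Lemma real_jac_kernel0 (a : R) (v : 'I_m -> R) : v i = 0 ->
  (forall j, v j = real_jac j (lshift m ord0) * a +
    \sum_k real_jac j (rshift 1 k) * v k) ->
  a = 0 /\ forall j, v j = 0.
Proof.
have [j1 [k [k0 hk]]] := exists_z_dependence irr sol n_gt0 Uin_gt0.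
have [_ _ _ connected] := irr.
apply: (bordered_kernel0 (w := fun j => reC (gf_val U y 0 j - gf_val U x 0 j))
  (s := reC (y - x)) (j1 := j1) _ _ connected) =>
    [j l|j l /asboolP[k' [k'l hk']]|j|j|||j].
- exact: real_jac_ge0.
- exact: real_jac_gt0 k'l hk'.
- apply: (@lt_reC _ 0); rewrite subr_gt0.
  exact: (gf_val_lt irr sol n_gt0 Uin_gt0 j x_gt0 xy yU).
- exact: real_jac_ge0.
- exact: real_jac_gt0 k0 hk.
- by apply: (@lt_reC _ 0); rewrite subr_gt0.
- have /le_reC := gf_val_increment_ge j.
  by rewrite (additive_jac_apply _ _ _ (@reC_mul_ge0 R)).
Qed.

Lemma aug_grad_unitmx : aug_grad h i zeta \in unitmx.
Proof.
apply: unitmx_of_injective => e /aug_grad_kernel[ei ej].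
have proj_eq0 (p : {additive C -> R}) :
    (forall c z, 0 <= c -> p (c * z) = reC c * p z) ->
    p (e 0 (lshift m ord0)) = 0 /\ forall j, p (rsubmx e 0 j) = 0.
  move=> pM; apply: real_jac_kernel0 => [|j]; first by rewrite ei (raddf0 p).
  by rewrite [in LHS]ej additive_jac_apply.
have [z_re v_re] := proj_eq0 _ (@reC_mul_ge0 R).
have [z_im v_im] := proj_eq0 _ (@imC_mul_ge0 R).
rewrite -[e]hsubmxK -[RHS]row_mx0; congr row_mx; apply/rowP => k.
  by rewrite (ord1 k) !mxE; exact: eq_reC_imC.
by rewrite [RHS]mxE; apply: eq_reC_imC; [exact: v_re|exact: v_im].
Qed.

Lemma newton_quadratic_at_solution : gf_val U x 0 i = 1 ->
  newton_cvg_quadratically_near (augmented_map h i) (conv_dom h) zeta.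
Proof.
move=> Ui1.
have [d [B [d0 B0 h_approx]]] := conv_dom_quad_approx zeta_conv_dom zeta_ge0.
have aug_approx := aug_quad_approx i B0 h_approx.
apply: (newton_quadratic d0 B0 _ aug_approx aug_grad_unitmx).
  rewrite /augmented_map row_mxKr Ui1 subrr.
  have -> : sys_map h zeta = gf_val U x.
    apply/rowP => j; rewrite sys_mapE.
    by have [_ ->] := sol_extends wf sol j x_gt0 xU.
  by rewrite subrr /zU_point raddf0 row_mx0.
by apply: open_nbhs_nbhs; split; [exact: open_interior|exact: zeta_conv_dom].
Qed.

End NewtonAtSolution.

(* Without [u0_lt1], implicit in the source, the system U = 2 + z * U, with
   solution 2 / (1 - z), is a counterexample. *)
Theorem theorem4p8 (R : realType) (m : nat) (h : system R m) (U : gf R m)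
    (i : 'I_m)
    (h_irr : irreducible_system h)
    (U_sol : gf_solution h U)
    (u0_lt1 : reC (gf_val U 0 0 i) < 1)
    (urho_gt1 : (1 < value_at_radius U i)%E) :
  exists (t : R) (B : 'rV[R]_m),
    [/\ 0 < t /\ (t%:E < conv_radius U)%E,
        forall j, 0 <= B 0 j,
        gf_val U (toC t) 0 i = 1,
        map_mx (@toC R) B = gf_val U (toC t) &
        newton_cvg_quadratically_near (augmented_map h i) (conv_dom h)
          (zU_point (toC t) (map_mx (@toC R) B))].
Proof.
have wf := irreducible_wf h_irr.
have [t [t0 t_lt Ut1]] :=
  gf_val_eq_before_radius U_sol wf ler01 u0_lt1 urho_gt1.
have [s ts sU] := gf_cvg_beyond (ltW t0) t_lt.
pose y := (t + s) / 2.
have [ty ys] : t < y /\ y < s by rewrite /y; lra.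
have t0' : 0 < toC t by rewrite toC_gt0.
have ty' : toC t < toC y by rewrite lt_toC.
have ys' : toC y < toC s by rewrite lt_toC.
have Ut_ge0 j : 0 <= gf_val U (toC t) 0 j.
  apply: (gf_val_ge0 wf U_sol j (ltW t0')).
  exact: (gf_cvg_le wf U_sol sU (ltW t0') (ltW (lt_trans ty' ys'))).
have [n n0 Un] : exists2 n, (0 < n)%N & 0 < U i n.
  apply: (exists_nonconstant_coef_gt0 wf U_sol (x := toC t)).
  by apply: contraTneq u0_lt1 => <-; rewrite Ut1 ltxx.
have BE : map_mx (@toC R) (map_mx (@reC R) (gf_val U (toC t))) =
    gf_val U (toC t).
  by apply/rowP => j; rewrite 2!mxE ge0_reCK.
exists t, (map_mx (@reC R) (gf_val U (toC t))); rewrite BE; split=> // [j|].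
  by rewrite mxE; exact: le_reC (Ut_ge0 j).
exact: (newton_quadratic_at_solution h_irr U_sol n0 Un t0' ty' ys' sU Ut1).
Qed.
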